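(* For every real $u>1$ and every positive integer $d$ there exists $k>1$, depending only on $u$ and $d$, with the following property. Let $K$ be a finitely generated torsion-free group such that every finitely generated subgroup $H$ of $K$ either satisfies $\omega(H)\geq u$ or is isomorphic to $\mathbb{Z}^n$ for some $0\leq n\leq d$. Then for any non-proper HNN extension $G=K\rtimes_\alpha\mathbb{Z}$, where $\alpha$ is an automorphism of $K$ having no periodic conjugacy classes, and any finitely generated subgroup $S$ of $G$, either $\omega(S)\geq k$ or $S\cong\mathbb{Z}^n$ for some $0\leq n\leq d$.
   Context: For a finitely generated group $G$ and a finite generating set $A$ of $G$, let $\gamma_A(n)$ be the number of elements of $G$ of word length at most $n$ with respect to $A\cup A^{-1}$, and let $\omega(G,A)=\lim_{n\to\infty}\gamma_A(n)^{1/n}$ (the limit exists since $\gamma_A$ is submultiplicative). The growth constant of $G$ is $\omega(G)=\inf_A \omega(G,A)$, the infimum being over all finite generating sets $A$ of $G$. For an automorphism $\alpha$ of $K$, the non-proper HNN extension is $K\rtimes_\alpha\mathbb{Z}=\langle K,t\mid tkt^{-1}=\alpha(k)\ (k\in K)\rangle$. An automorphism $\alpha$ of $K$ has a periodic conjugacy class if there exist a non-identity element $x\in K$ and a non-zero integer $n$ such that $\alpha^n(x)$ is conjugate to $x$ in $K$. *)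

(* Defs.v *)
From HB Require Import structures.
From mathcomp Require Import all_boot all_order all_algebra finmap.
From mathcomp Require Import boolp classical_sets functions cardinality reals.
From mathcomp Require Import topology normedtype sequences exp.

Set Implicit Arguments.
Unset Strict Implicit.
Unset Printing Implicit Defensive.

Import Order.TTheory GRing.Theory Num.Theory.
Import numFieldNormedType.Exports.

Local Open Scope classical_set_scope.
Local Open Scope group_scope.

(* A subgroup is a [groupClosed G]; [subgroup H] is the group it carries. *)
Definition subgroup (G : groupType) (H : groupClosed G) : Type :=
  {x : G | x \in H}.

Section SubgroupIsGroup.
Variables (G : groupType) (H : groupClosed G).

Lemma subgroup_closed : group_closed H.
Proof. by split; [exact: gpred1 | exact: gpredF]. Qed.

HB.instance Definition _ := SubChoice.on (subgroup H).
HB.instance Definition _ :=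
  SubChoice_isSubGroup.Build G (fun x => x \in H) (subgroup H) subgroup_closed.
End SubgroupIsGroup.

Section Growth.
Variable G : groupType.
Implicit Types A : set G.

(* The elements of word length at most [n] with respect to A and its inverses. *)
Definition word_ball A (n : nat) : set G :=
  [set g | exists w : seq G, [/\ (size w <= n)%N,
     (forall x, x \in w -> A x \/ A x^-1) & g = \prod_(x <- w) x]].

Lemma finite_word_ball A n : finite_set A -> finite_set (word_ball A n).
Proof.
move=> finA; elim: n => [|n IHn].
  apply: (@sub_finite_set _ _ [set 1]) => // g [w [+ _ ->]].
  by case: w => //= _; rewrite big_nil.
pose B := [set 1] `|` (A `|` [set x^-1 | x in A]).
have finB : finite_set B.
  by rewrite !finite_setU; split=> //; split=> //; exact: finite_image.
apply: (sub_finite_set _ 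
  (@finite_image2 _ _ _ _ _ (fun x y : G => x * y) finB IHn)) => g [[|x w] [sw wA ->]].
  exists 1; first by left.
  by exists 1; rewrite ?big_nil ?mul1g //; exists [::]; split; rewrite ?big_nil.
exists x.
  right; have [Ax|Ax] := wA x (mem_head _ _); first by left.
  by right; exists x^-1; rewrite ?invgK.
exists (\prod_(y <- w) y); last by rewrite big_cons.
by exists w; split=> // y yw; apply: wA; rewrite inE yw orbT.
Qed.

Definition generates A : Prop := forall g : G, exists n, word_ball A n g.

Definition finitely_generated : Prop :=
  exists2 A : set G, finite_set A & generates A.

Definition growth_fun A (n : nat) : nat := #|` fset_set (word_ball A n)|.

Definition growth_rate (R : realType) A : R :=
  limn (fun n => ((growth_fun A n)%:R `^ n%:R^-1 : R)%R).

Definition growth_constant (R : realType) : R :=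
  inf [set growth_rate R A | A in [set A | finite_set A /\ generates A]].

Definition torsion_free : Prop :=
  forall (x : G) (n : nat), (0 < n)%N -> x ^+ n = 1 -> x = 1.

Definition isomorphic_Zn (n : nat) : Prop :=
  exists2 f : 'rV[int]_n -> G,
    (forall x y, f (x + y)%R = f x * f y) & bijective f.

End Growth.

Record automorphism (K : groupType) := Automorphism {
  aut_fun :> K -> K;
  aut_inv : K -> K;
  aut_morph : {morph aut_fun : x y / x * y};
  aut_funK : cancel aut_fun aut_inv;
  aut_invK : cancel aut_inv aut_fun }.

Section Automorphisms.
Variables (K : groupType) (alpha : automorphism K).

Definition aut_exp (n : int) (x : K) : K :=
  match n with
  | Posz m => iter m alpha x
  | Negz m => iter m.+1 (aut_inv alpha) x
  end.

Definition has_periodic_conjugacy_class : Prop :=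
  exists x : K, exists n : int,
    [/\ x <> 1, n <> 0%R & exists y : K, aut_exp n x = y * x * y^-1].

Lemma aut_exp0 x : aut_exp 0%R x = x.
Proof. by []. Qed.

Lemma aut_inv_morph : {morph aut_inv alpha : x y / x * y}.
Proof.
move=> x y; apply: (can_inj (aut_funK alpha)).
by rewrite aut_morph !aut_invK.
Qed.

Lemma aut_exp_morph n : {morph aut_exp n : x y / x * y}.
Proof.
by case: n => m x y; rewrite /aut_exp; [elim: m | elim: m.+1] => //= ? ->;
  rewrite ?aut_morph ?aut_inv_morph.
Qed.

Lemma aut_exp1 n : aut_exp n 1 = 1.
Proof. by apply: (@mulgI _ (aut_exp n 1)); rewrite -aut_exp_morph !mulg1. Qed.

Lemma aut_expS n x : aut_exp (n + 1)%R x = alpha (aut_exp n x).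
Proof.
case: n => [m|[|m]]; first by rewrite -PoszD addn1.
  by rewrite /= aut_invK.
have -> : (Negz m.+1 + 1 = Negz m)%R by rewrite !NegzE -addn1 PoszD opprD addrNK.
by rewrite /= aut_invK.
Qed.

Lemma aut_expB1 n x : aut_exp (n - 1)%R x = aut_inv alpha (aut_exp n x).
Proof. by rewrite -[in RHS](subrK 1%R n) aut_expS aut_funK. Qed.

Lemma aut_expD m n x : aut_exp (m + n)%R x = aut_exp m (aut_exp n x).
Proof.
elim/int_rect: m => [|m IHm|m IHm]; first by rewrite add0r.
  by rewrite -addn1 PoszD addrAC !aut_expS IHm.
by rewrite -addn1 PoszD opprD addrAC !aut_expB1 IHm.
Qed.

End Automorphisms.

Arguments aut_exp : simpl never.

(* The pair (k, n) stands for k t^n, where t k t^-1 = alpha k. The group law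
   depends on alpha, so the type must too. *)
Record hnn (K : groupType) (alpha : automorphism K) :=
  Hnn { hnn_base : K; hnn_stable : int }.

Section HnnGroup.
Variables (K : groupType) (alpha : automorphism K).
Local Notation hnn := (hnn alpha).
Local Notation Hnn := (@Hnn K alpha).

Definition hnn_pair (g : hnn) : K * int := (hnn_base g, hnn_stable g).
Definition pair_hnn (p : K * int) : hnn := Hnn p.1 p.2.

Lemma hnn_pairK : cancel hnn_pair pair_hnn.
Proof. by case. Qed.

HB.instance Definition _ := Choice.copy hnn (can_type hnn_pairK).

Definition hnn_mul (g h : hnn) : hnn :=
  Hnn (hnn_base g * aut_exp alpha (hnn_stable g) (hnn_base h))
      (hnn_stable g + hnn_stable h)%R.

Definition hnn_one : hnn := Hnn 1 0%R.

Definition hnn_inv (g : hnn) : hnn :=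
  Hnn (aut_exp alpha (- hnn_stable g)%R (hnn_base g)^-1) (- hnn_stable g)%R.

Lemma hnn_mulA : associative hnn_mul.
Proof.
case=> k m [l n] [p q]; rewrite /hnn_mul /=.
by rewrite aut_exp_morph aut_expD mulgA addrA.
Qed.

Lemma hnn_mul1 : left_id hnn_one hnn_mul.
Proof. by case=> k m; rewrite /hnn_mul /= mul1g add0r. Qed.

Lemma hnn_mulr1 : right_id hnn_one hnn_mul.
Proof. by case=> k m; rewrite /hnn_mul /= aut_exp1 mulg1 addr0. Qed.

Lemma hnn_mulV : left_inverse hnn_one hnn_inv hnn_mul.
Proof.
by case=> k m; rewrite /hnn_mul /= -aut_exp_morph mulVg aut_exp1 addNr.
Qed.

Lemma hnn_mulrV : right_inverse hnn_one hnn_inv hnn_mul.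
Proof. by case=> k m; rewrite /hnn_mul /= -aut_expD subrr mulgV. Qed.

HB.instance Definition _ :=
  isGroup.Build hnn hnn_mulA hnn_mul1 hnn_mulr1 hnn_mulV hnn_mulrV.

Lemma hnn_baseM k l : Hnn (k * l) 0%R = Hnn k 0%R * Hnn l 0%R.
Proof. by []. Qed.

Lemma hnn_conj k : Hnn 1 1%R * Hnn k 0%R * (Hnn 1 1%R)^-1 = Hnn (alpha k) 0%R.
Proof.
by congr Hnn; rewrite /= mul1g -aut_expD /= invg1 mulg1.
Qed.

End HnnGroup.

Arguments Hnn {K} alpha.

(* Universal property of the presentation < K, t | t k t^-1 = alpha k >. *)
Section HnnUniversal.
Variables (K : groupType) (alpha : automorphism K) (L : groupType).
Variables (f : K -> L) (s : L).
Hypothesis f_morph : {morph f : x y / x * y}.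
Hypothesis f_conj : forall k, s * f k * s^-1 = f (alpha k).

Let zexp (n : int) : L :=
  match n with Posz m => s ^+ m | Negz m => s ^- m.+1 end.

Let zexpS n : zexp (n + 1)%R = s * zexp n.
Proof.
case: n => [m|[|m]]; first by rewrite -PoszD addn1 /= expgS.
  by rewrite /= expg1 mulgV.
have -> : (Negz m.+1 + 1 = Negz m)%R by rewrite !NegzE -addn1 PoszD opprD addrNK.
by rewrite /= (expgSr _ m.+1) invgM mulVKg.
Qed.

Let zexpB1 n : zexp (n - 1)%R = s^-1 * zexp n.
Proof. by rewrite -[in RHS](subrK 1%R n) zexpS mulKg. Qed.

Let zexpD m n : zexp (m + n)%R = zexp m * zexp n.
Proof.
elim/int_rect: m => [|m IHm|m IHm]; first by rewrite add0r mul1g.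
  by rewrite -addn1 PoszD addrAC !zexpS IHm mulgA.
by rewrite -addn1 PoszD opprD addrAC !zexpB1 IHm mulgA.
Qed.

Let zexp_conj n k : zexp n * f k = f (aut_exp alpha n k) * zexp n.
Proof.
have fS x : s * f x = f (alpha x) * s by rewrite -f_conj mulgVK.
have fV x : s^-1 * f x = f (aut_inv alpha x) * s^-1.
  by apply: (mulgI s); rewrite mulVKg mulgA fS aut_invK mulgK.
elim/int_rect: n k => [|m IHm|m IHm] k; first by rewrite mul1g mulg1.
  by rewrite -addn1 PoszD zexpS -mulgA IHm mulgA fS -aut_expS mulgA.
by rewrite -addn1 PoszD opprD zexpB1 -mulgA IHm mulgA fV -aut_expB1 mulgA.
Qed.

Lemma hnn_universal : exists! h : hnn alpha -> L,
  [/\ {morph h : x y / x * y}, (forall k, h (Hnn alpha k 0%R) = f k) &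
      h (Hnn alpha 1 1%R) = s].
Proof.
have f1 : f 1 = 1 by apply: (@mulgI _ (f 1)); rewrite -f_morph !mulg1.
exists (fun g => f (hnn_base g) * zexp (hnn_stable g)); split.
  split=> [[k m] [l n]|k|] /=; last by rewrite f1 mul1g expg1.
    by rewrite f_morph zexpD -!mulgA [_ * (f l * _)]mulgA zexp_conj !mulgA.
  by rewrite mulg1.
move=> h [hM hK hs]; apply/funext => -[k n] /=.
have -> : Hnn alpha k n = Hnn alpha k 0%R * Hnn alpha 1 n.
  by congr Hnn; rewrite /= ?mulg1 ?add0r.
rewrite hM hK; congr (_ * _); symmetry.
have h1 : h (Hnn alpha 1 0%R) = 1 by rewrite hK f1.
have hS m : h (Hnn alpha 1 (m + 1)%R) = s * h (Hnn alpha 1 m).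
  rewrite -hs -hM; congr h; congr Hnn; last by rewrite addrC.
  by rewrite /= (aut_exp1 alpha 1%R) mulg1.
have hB m : h (Hnn alpha 1 (m - 1)%R) = s^-1 * h (Hnn alpha 1 m).
  by rewrite -[in RHS](subrK 1%R m) hS mulKg.
elim/int_rect: n => [//|m IHm|m IHm].
  by rewrite -addn1 PoszD hS IHm zexpS.
by rewrite -addn1 PoszD opprD hB IHm zexpB1.
Qed.

End HnnUniversal.

(* Main.v *)
(* Assume that S does not lie in K and meets K nontrivially; in the remaining
   cases S is a subgroup of K or infinite cyclic. An element of nonzero exponent
   commutes with no y <> 1 of K, as that would be a periodic conjugacy class. So
   every finite generating set A of S contains some a of nonzero exponent and two
   elements whose commutator x <> 1 lies in K. Put x_i = a^i x a^-i.
   - If <x_0, ..., x_d> has growth constant at least u, so has S up to a root,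
     because the x_i with i <= d have bounded length. Otherwise x_0, ..., x_d lie
     in some Z^n with n <= d: they commute and satisfy a primitive integer
     relation c.
   - If, for some s = 2^j with j bounded in terms of d, the products
     x_0^e_0 x_s^e_1 x_2s^e_2 ... with exponents in {0, 1} are pairwise distinct,
     then S has growth at least 2^(1/(4+s)), because such a product equals
     x^e_0 a^s x^e_1 a^s ... up to a power of a.
   - Suppose that this fails for all these s. A coincidence for s = 1 and the
     relation c force all x_i to commute, so that Z[X] acts on the group they
     generate, X acting as conjugation by a. The primitive annihilator p of x of
     least degree has degree at most d and divides, for each s, some g(X^s) with
     g <> 0 and coefficients in {-1, 0, 1}. Hence p is monic and |z^s| <= 2 for
     all its roots z. Replacing the roots of p by their squares again and again
     stays in a finite set of integer polynomials, so some root is a root of unity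
     of order r, say. Then gcd(p, X^r - 1) is not constant, which gives y <> 1 in
     K commuting with a^r: a contradiction. *)
Require Import Defs.
From HB Require Import structures.
From mathcomp Require Import all_boot all_order all_algebra all_field finmap reals.
From mathcomp Require Import boolp classical_sets functions cardinality.
From mathcomp Require Import topology normedtype sequences exp.
From mathcomp Require Import zify ring.

Set Implicit Arguments.
Unset Strict Implicit.
Unset Printing Implicit Defensive.

Import Order.TTheory GRing.Theory Num.Theory.
Import numFieldNormedType.Exports.
Local Open Scope ring_scope.

(** * Growth rates *)

Section Fekete.
Variables (R : realType) (g : nat -> nat).
Hypotheses (g_gt0 : forall n, (0 < g n)%N)
  (g_submul : forall m n, (g (m + n) <= g m * g n)%N).

Let a (n : nat) : R := (g n)%:R `^ n%:R^-1.

(** For n = qN + r, submultiplicativity peels off q factors [g N]; what remains is [g r] with r < N,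
    absorbed in the maximum. *)
Lemma submul_div (N n : nat) : (0 < N)%N ->
  (g n <= g N ^ (n %/ N) * \max_(i < N) g i)%N.
Proof.
move=> N0; rewrite {1}(divn_eq n N).
have small : (g (n %% N) <= \max_(i < N) g i)%N.
  by rewrite -[X in g X]/(nat_of_ord (Ordinal (ltn_pmod n N0))); apply: leq_bigmax.
elim: (n %/ N)%N => [|q IHq]; first by rewrite mul0n add0n expn0 mul1n.
by rewrite mulSn -addnA expnS -mulnA; apply: leq_trans (g_submul _ _) _;
  rewrite leq_mul2l IHq orbT.
Qed.

Let aX n : (0 < n)%N -> a n ^+ n = (g n)%:R.
Proof.
move=> n0; rewrite -powR_mulrn ?powR_ge0// -powRrM mulVf ?pnatr_eq0 ?lt0n_neq0//.
by rewrite powRr1.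
Qed.

(** Index 0 is left out: as 0^-1 = 0, [a 0] equals 1 whatever [g] is. *)
Let E := [set a n | n in [set n : nat | (0 < n)%N]]%classic.

Let E_inf : has_inf E.
Proof.
split; first by exists (a 1), 1%N.
by exists 0 => _ [n _ <-]; exact: powR_ge0.
Qed.

Let inf_le n : (0 < n)%N -> inf E <= a n.
Proof. by move=> n0; apply: ge_inf; [exact: E_inf.2 | exists n]. Qed.

(** Fekete's lemma in multiplicative form. For fixed N, [submul_div] gives a(n) <= a(N) M^(1/n) with
    M the maximum of [g] below N. Here M^(1/n) tends to 1, and a(N) can be chosen close to the
    infimum. *)
Lemma fekete_cvg : (a n @[n --> \oo] --> inf E)%classic.
Proof.
apply/cvgrPdist_lt => e e0.
have [_ [N /= N0 <-] aN] := @inf_adherent _ E e e0 E_inf.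
pose M := \max_(i < N) g i.
have M0 : (0 < M)%N.
  by apply: leq_trans (g_gt0 (Ordinal N0)) _; exact: (leq_bigmax (Ordinal N0)).
have ub n : (0 < n)%N -> a n <= a N * expR (n%:R^-1 * ln M%:R).
  move=> n0; have -> : expR (n%:R^-1 * ln M%:R) = (M%:R : R) `^ n%:R^-1.
    by rewrite /powR pnatr_eq0 (gtn_eqF M0).
  apply: (@le_trans _ _ (((g N ^ (n %/ N) * M)%N%:R : R) `^ n%:R^-1)).
    apply: ge0_ler_powR; rewrite ?invr_ge0 ?nnegrE // ler_nat; exact: submul_div.
  rewrite natrM powRM // ler_pM2r ?powR_gt0 ?ltr0n //.
  rewrite natrX -powR_mulrn // -powRrM /a; apply: ler_powR; first by rewrite ler1n.
  rewrite ler_pdivrMr ?ltr0n // mulrC ler_pdivlMr ?ltr0n // -natrM ler_nat.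
  exact: leq_divM.
have cv : (a N * expR (n%:R^-1 * ln M%:R) @[n --> \oo] --> a N)%classic.
  rewrite -[X in (_ --> X)%classic]mulr1; apply: cvgMl_tmp.
  rewrite -[X in (_ --> X)%classic](@expR0 R).
  apply: continuous_cvg; first exact: continuous_expR.
  rewrite -[X in (_ --> X)%classic](mul0r (ln M%:R)); apply: cvgMr_tmp.
  apply/gtr0_cvgV0; first by near=> n; rewrite ltr0n; near: n; exists 1%N.
  exact: cvgr_idn.
near=> n; rewrite ler0_norm ?opprB; last first.
  by rewrite subr_le0; apply: inf_le; near: n; exists 1%N.
rewrite ltrBlDr (addrC e); apply: le_lt_trans (ub n _) _; first by near: n; exists 1%N.
near: n; exact: (cvgr_lt _ cv _ aN).
Unshelve. all: by end_near.
Qed.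

Lemma fekete_le n : (limn a) ^+ n <= (g n)%:R.
Proof.
rewrite (cvg_lim _ fekete_cvg) //.
case: n => [|n]; first by rewrite expr0 ler1n.
rewrite -aX // lerXn2r ?nnegrE ?powR_ge0 ?inf_le //.
by apply: lb_le_inf E_inf.1 _ => _ [m _ <-]; exact: powR_ge0.
Qed.

Lemma fekete_ge k : 0 <= k -> (forall n, k ^+ n <= (g n)%:R) -> k <= limn a.
Proof.
move=> k0 kg; rewrite (cvg_lim _ fekete_cvg) //.
apply: lb_le_inf E_inf.1 _ => _ [n n0 <-].
by rewrite -(@ler_pXn2r _ n) // ?nnegrE ?powR_ge0 // aX.
Qed.

End Fekete.

Section WordBall.
Local Open Scope group_scope.
Variable G : groupType.
Implicit Types (A B : set G) (g h x : G).

Lemma word_ball_id A : word_ball A 0 1.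
Proof. by exists [::]; split; rewrite ?big_nil. Qed.

Lemma word_ballW A m n g : (m <= n)%N -> word_ball A m g -> word_ball A n g.
Proof. by move=> mn [w [sw wA ->]]; exists w; split=> //; exact: leq_trans mn. Qed.

Lemma word_ballM A m n g h :
  word_ball A m g -> word_ball A n h -> word_ball A (m + n) (g * h).
Proof.
move=> [v [sv vA ->]] [w [sw wA ->]]; exists (v ++ w); split.
- by rewrite size_cat leq_add.
- by move=> x; rewrite mem_cat => /orP[]; [exact: vA | exact: wA].
- by rewrite big_cat.
Qed.

Lemma word_ballV A n g : word_ball A n g -> word_ball A n g^-1.
Proof.
move=> [w [sw wA ->]]; exists (rev [seq x^-1 | x <- w]); split.
- by rewrite size_rev size_map.
- by move=> x; rewrite mem_rev => /mapP[y yw ->]; rewrite invgK or_comm; exact: wA.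
- by rewrite -map_rev big_map prodgV revK.
Qed.

Lemma word_ball_gen A x : A x -> word_ball A 1 x.
Proof.
move=> Ax; exists [:: x]; split; rewrite ?big_seq1 // => y.
by rewrite inE => /eqP->; left.
Qed.

Lemma word_ballX A m g n : word_ball A m g -> word_ball A (m * n) (g ^+ n).
Proof.
move=> Ag; elim: n => [|n IHn]; first by rewrite muln0; exact: word_ball_id.
by rewrite expgS mulnS; exact: word_ballM.
Qed.

Lemma word_ball_trans A B c n g :
  (forall y, B y -> word_ball A c y) -> word_ball B n g -> word_ball A (c * n) g.
Proof.
move=> BA [w [sw wB ->]]; apply: (@word_ballW _ (c * size w)%N).
  by rewrite leq_mul2l sw orbT.
elim: w wB {sw} => [|x w IHw] wB; first by rewrite big_nil muln0; exact: word_ball_id.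
rewrite big_cons mulnS; apply: word_ballM.
  have [/BA //|/BA/word_ballV] := wB x (mem_head _ _); by rewrite invgK.
by apply: IHw => y yw; apply: wB; rewrite inE yw orbT.
Qed.

Lemma word_ballD A m n g : word_ball A (m + n) g ->
  exists x y, [/\ word_ball A m x, word_ball A n y & g = x * y].
Proof.
move=> [w [sw wA ->]]; exists (\prod_(x <- take m w) x), (\prod_(x <- drop m w) x).
split; last by rewrite -big_cat cat_take_drop.
- exists (take m w); split=> // [|x /mem_take]; last exact: wA.
  by rewrite size_take; case: ltnP.
- exists (drop m w); split=> // [|x /mem_drop]; last exact: wA.
  by rewrite size_drop leq_subLR.
Qed.

Lemma growth_fun_ge A n (s : seq G) : finite_set A -> uniq s ->
  (forall x, x \in s -> word_ball A n x) -> (size s <= growth_fun A n)%N.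
Proof.
move=> fA us sA; apply: uniq_leq_size us _ => x /sA Ax.
by rewrite in_fset_set ?inE //; exact: finite_word_ball.
Qed.

Lemma growth_fun_gt0 A n : finite_set A -> (0 < growth_fun A n)%N.
Proof.
move=> fA; apply: (@growth_fun_ge A n [:: 1]) => // x; rewrite inE => /eqP->.
by apply: word_ballW (word_ball_id A).
Qed.

Lemma growth_fun_submul A m n : finite_set A ->
  (growth_fun A (m + n) <= growth_fun A m * growth_fun A n)%N.
Proof.
move=> fA; rewrite /growth_fun -(size_allpairs *%g).
apply: uniq_leq_size (fset_uniq _) _ => g.
rewrite in_fset_set ?inE; last exact: finite_word_ball.
move=> /word_ballD[x [y [Ax Ay ->]]]; apply: allpairs_f;
  by rewrite in_fset_set ?inE //; exact: finite_word_ball.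
Qed.

Lemma growth_fun_expn A m n : finite_set A ->
  (growth_fun A (m * n) <= growth_fun A m ^ n)%N.
Proof.
move=> fA; elim: n => [|n IHn].
  (* The ball of radius 0 is reduced to the identity, which does not follow from
     submultiplicativity. *)
  rewrite muln0; apply: (@leq_trans (size [:: 1 : G])) => //.
  apply: uniq_leq_size (fset_uniq _) _ => g.
  rewrite in_fset_set; last exact: finite_word_ball.
  by rewrite !inE => -[[|x w] [// _ _ ->]]; rewrite big_nil.
by rewrite mulnS expnS; apply: leq_trans (growth_fun_submul _ _ fA) _;
  rewrite leq_mul2l IHn orbT.
Qed.

End WordBall.

Section GrowthRate.
Variables (R : realType) (G : groupType).
Implicit Type A : set G.

Lemma growth_rate_le A n : finite_set A ->
  growth_rate R A ^+ n <= (growth_fun A n)%:R.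
Proof.
by move=> fA; apply: fekete_le => [m|*];
  [exact: growth_fun_gt0 | exact: growth_fun_submul].
Qed.

Lemma growth_rate_ge A k : finite_set A -> 0 <= k ->
  (forall n, k ^+ n <= (growth_fun A n)%:R) -> k <= growth_rate R A.
Proof.
by move=> fA; apply: fekete_ge => [m|*];
  [exact: growth_fun_gt0 | exact: growth_fun_submul].
Qed.

(** Finite generation makes the set of growth rates non-empty; the infimum of the empty set would be
    0 by default. *)
Lemma growth_constant_ge (k : R) : finitely_generated G -> 0 <= k ->
  (forall A, finite_set A -> generates A ->
     forall n, k ^+ n <= (growth_fun A n)%:R) -> k <= growth_constant G R.
Proof.
move=> [A fA gA] k0 kA; apply: lb_le_inf => [|_ [B [fB gB] <-]];
  first by exists (growth_rate R A), A.
by apply: growth_rate_ge => //; exact: kA.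
Qed.

Lemma growth_constant_le (k : R) A n : 0 <= k -> k <= growth_constant G R ->
  finite_set A -> generates A -> k ^+ n <= (growth_fun A n)%:R.
Proof.
move=> k0 kG fA gA; apply: le_trans (growth_rate_le n fA).
have kA : k <= growth_rate R A.
  apply: le_trans kG _; apply: ge_inf; last by exists A.
  exists 0 => _ [B [fB _] <-]; apply: growth_rate_ge => // -[|m].
    by rewrite expr0 ler1n growth_fun_gt0.
  by rewrite expr0n.
by rewrite lerXn2r // nnegrE (le_trans k0).
Qed.

(** Turns v^m elements in each ball of radius cm into growth k, when k^c <= v, by comparing c-th
    powers: k^(cn) <= v^n <= gamma(cn) <= gamma(n)^c. *)
Lemma growth_fun_root A c n (k v : R) : finite_set A -> 0 <= k -> k ^+ c <= v ->
  (forall m, v ^+ m <= (growth_fun A (c * m))%:R) -> (0 < c)%N ->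
  k ^+ n <= (growth_fun A n)%:R.
Proof.
move=> fA k0 kv vA c0; rewrite -(@ler_pXn2r _ c) // ?nnegrE ?exprn_ge0 //.
rewrite -exprM mulnC exprM; apply: (@le_trans _ _ (v ^+ n)).
  by rewrite lerXn2r ?nnegrE ?exprn_ge0 // (le_trans _ kv) ?exprn_ge0.
apply: le_trans (vA n) _; rewrite -natrX ler_nat mulnC; exact: growth_fun_expn.
Qed.

End GrowthRate.

(** * Transport of balls and growth along injective morphisms *)

Section Injection.
Local Open Scope classical_set_scope.
Local Open Scope group_scope.
Variables (G H : groupType) (f : G -> H).
Hypotheses (fM : {morph f : x y / x * y}) (f_inj : injective f).

Lemma morph_one : f 1 = 1.
Proof. by apply: (@mulgI _ (f 1)); rewrite -fM !mulg1. Qed.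

Lemma morph_inv x : f x^-1 = (f x)^-1.
Proof. by apply: (@mulgI _ (f x)); rewrite -fM !mulgV morph_one. Qed.

Lemma morph_prod (s : seq G) : f (\prod_(x <- s) x) = \prod_(x <- map f s) x.
Proof.
by elim: s => [|x s IHs]; rewrite /= ?big_nil ?morph_one // !big_cons fM IHs.
Qed.

Lemma word_ball_image A n : word_ball (f @` A) n = f @` word_ball A n.
Proof.
apply/seteqP; split=> [_ [w [sw wA ->]]|_ [_ [w [sw wA ->]] <-]].
  have [v vw vA] : exists2 v, w = map f v & forall x, x \in v -> A x \/ A x^-1.
    elim: w wA {sw} => [|x w IHw] wA; first by exists [::].
    have [|v -> vA] := IHw; first by move=> y yw; apply: wA; rewrite inE yw orbT.
    have [y xy Ay] : exists2 y, x = f y & A y \/ A y^-1.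
      have [[y Ay <-]|[y Ay yx]] := wA x (mem_head _ _); first by exists y; tauto.
      by exists y^-1; rewrite ?morph_inv ?yx ?invgK //; tauto.
    exists (y :: v); rewrite /= ?xy // => z; rewrite inE => /predU1P[->//|]; exact: vA.
  exists (\prod_(x <- v) x); last by rewrite vw morph_prod.
  by exists v; split=> //; rewrite -(size_map f) -vw.
exists (map f w); split; rewrite ?size_map ?morph_prod // => _ /mapP[x xw ->].
have [Ax|Ax] := wA x xw; first by left; exists x.
by right; exists x^-1 => //; exact: morph_inv.
Qed.

Lemma growth_fun_image A n : finite_set A ->
  growth_fun (f @` A) n = growth_fun A n.
Proof.
move=> fA; have fW := finite_word_ball n fA.
rewrite /growth_fun word_ball_image fset_set_image //.
by rewrite card_imfset.
Qed.

End Injection.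

(** * Commutation in orbits of an endomorphism *)

Section IntegerPowers.
Local Open Scope group_scope.
Variable G : groupType.
Implicit Types (x y z : G) (a b : int).

Definition zpowg x a : G :=
  match a with Posz n => x ^+ n | Negz n => x ^- n.+1 end.

Lemma zpowg0 x : zpowg x 0%R = 1. Proof. by []. Qed.

Lemma zpowg1 x : zpowg x 1%R = x. Proof. by []. Qed.

Lemma zpowgS x a : zpowg x (a + 1)%R = x * zpowg x a.
Proof.
case: a => [m|[|m]]; first by rewrite -PoszD addn1 /= expgS.
  by rewrite /= expg1 mulgV.
have -> : (Negz m.+1 + 1 = Negz m)%R by rewrite !NegzE -addn1 PoszD opprD addrNK.
by rewrite /= (expgSr _ m.+1) invgM mulVKg.
Qed.

Lemma zpowgB1 x a : zpowg x (a - 1)%R = x^-1 * zpowg x a.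
Proof. by rewrite -[in RHS](subrK 1%R a) zpowgS mulKg. Qed.

Lemma zpowgD x a b : zpowg x (a + b)%R = zpowg x a * zpowg x b.
Proof.
elim/int_rect: a => [|m IHm|m IHm]; first by rewrite add0r mul1g.
  by rewrite -addn1 PoszD addrAC !zpowgS IHm mulgA.
by rewrite -addn1 PoszD opprD addrAC !zpowgB1 IHm mulgA.
Qed.

Lemma zpowgN x a : zpowg x (- a)%R = (zpowg x a)^-1.
Proof. by apply: (@mulgI _ (zpowg x a)); rewrite -zpowgD subrr mulgV. Qed.

Lemma zpowgM x a b : zpowg x (a * b)%R = zpowg (zpowg x a) b.
Proof.
elim/int_rect: b => [|m IHm|m IHm]; first by rewrite mulr0.
  by rewrite -addn1 PoszD mulrDr mulr1 !zpowgD IHm.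
by rewrite -addn1 PoszD opprD mulrBr mulr1 !zpowgD IHm !zpowgN.
Qed.

Lemma zpowg_nat x n : zpowg x n%:Z%R = x ^+ n. Proof. by []. Qed.

Lemma commute_zpowg x y a : commute x y -> commute x (zpowg y a).
Proof.
by move=> xy; case: a => n; [exact: commuteX | exact/commuteV/commuteX].
Qed.

Lemma zpowgMn x y a : commute x y -> zpowg (x * y) a = zpowg x a * zpowg y a.
Proof.
move=> xy; case: a => n; rewrite /= ?expgMn // -invgM; congr _^-1.
exact: commuteX2.
Qed.

Lemma zpowg_abs x a : zpowg x `|a|%N = zpowg x a \/ zpowg x `|a|%N = (zpowg x a)^-1.
Proof. by case: a => n; [left | right; rewrite /= invgK]. Qed.

Lemma zpowg_eq1 x a : torsion_free G -> a != 0%R -> zpowg x a = 1 -> x = 1.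
Proof.
move=> tf a0 xa; apply: (tf x `|a|%N); first by rewrite absz_gt0.
by rewrite -zpowg_nat; have [->|->] := zpowg_abs x a; rewrite xa ?invg1.
Qed.

Lemma commute_word_ball (A : set G) n x g :
  (forall y, A y -> commute x y) -> word_ball A n g -> commute x g.
Proof.
move=> xA [w [_ wA ->]]; rewrite big_seq; apply: (big_ind (commute x)).
- exact: commute1.
- by move=> y z; exact: commuteM.
- move=> y /wA[/xA //|/xA]; move=> /commuteV; by rewrite invgK.
Qed.

Lemma commute_prod_nat x m n (F : nat -> G) :
  (forall i, (m <= i < n)%N -> commute x (F i)) ->
  commute x (\prod_(m <= i < n) F i).
Proof. by move=> xF; rewrite big_nat_cond; apply: commute_prod => i /andP[/xF]. Qed.

(** The relation can be solved for its k-th factor, which becomes a product of inverses of the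
    others. *)
Lemma commute_prod_term x n (F : nat -> G) k : (k < n)%N ->
  \prod_(0 <= i < n) F i = 1 ->
  (forall i, (i < n)%N -> i != k -> commute x (F i)) -> commute x (F k).
Proof.
move=> kn + xF; rewrite (@big_cat_nat _ _ _ k) ?(ltnW kn) //=.
rewrite (@big_ltn _ _ _ k n) //.
set a := \prod_(0 <= i < k) _; set b := \prod_(k.+1 <= i < n) _ => Fab.
have -> : F k = a^-1 * b^-1.
  by apply: (mulgI a); apply: (mulIg b); rewrite mulVKg mulVg -mulgA.
have xa : commute x a.
  apply: commute_prod_nat => i /andP[_ ik]; apply: xF; last by rewrite ltn_eqF.
  exact: ltn_trans kn.
have xb : commute x b.
  by apply: commute_prod_nat => i /andP[ki ?]; apply: xF; rewrite // gtn_eqF.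
by apply: commuteM; exact: commuteV.
Qed.

Lemma zpowg1n a : zpowg 1 a = 1.
Proof. by case: a => n; rewrite /= expg1n ?invg1. Qed.

Lemma zpowg_prod_nat n a (F : nat -> G) :
  (forall i j, (i < n)%N -> (j < n)%N -> commute (F i) (F j)) ->
  zpowg (\prod_(0 <= i < n) F i) a = \prod_(0 <= i < n) zpowg (F i) a.
Proof.
elim: n => [|n IHn] FF; first by rewrite !big_nil zpowg1n.
rewrite !big_nat_recr //= zpowgMn ?IHn //.
  by move=> i j i_n j_n; apply: FF; exact: ltnW.
by apply/commute_sym/commute_prod_nat => i /andP[_ i_n]; apply: FF => //; exact: ltnW.
Qed.

Lemma prodM_nat n (E F : nat -> G) :
  (forall i j, (i < n)%N -> (j < n)%N -> commute (E i) (F j)) ->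
  \prod_(0 <= i < n) (E i * F i) =
    (\prod_(0 <= i < n) E i) * \prod_(0 <= i < n) F i.
Proof.
elim: n => [|n IHn] EF; first by rewrite !big_nil mulg1.
rewrite !big_nat_recr //= IHn => [|i j i_n j_n]; last by apply: EF; exact: ltnW.
rewrite -!mulgA; congr (_ * _); rewrite !mulgA; congr (_ * _).
by apply/commute_sym/commute_prod_nat => i /andP[_ i_n]; apply: EF => //; exact: ltnW.
Qed.

Lemma zpowgX x e a : zpowg x a ^+ e = zpowg (x ^+ e) a.
Proof. by rewrite -!zpowg_nat -!zpowgM mulrC. Qed.

End IntegerPowers.

Section Morphism.
Local Open Scope group_scope.
Variables (G H : groupType) (f : G -> H).
Hypothesis fM : {morph f : x y / x * y}.

Lemma morphX n : {morph f : x / x ^+ n}.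
Proof. by move=> x; elim: n => [|n IHn]; rewrite ?(morph_one fM) // !expgS fM IHn. Qed.

Lemma morph_zpow a : {morph f : x / zpowg x a}.
Proof. by move=> x; case: a => n; rewrite /= ?(morph_inv fM) morphX. Qed.

Lemma morph_prod_nat m n (F : nat -> G) :
  f (\prod_(m <= i < n) F i) = \prod_(m <= i < n) f (F i).
Proof. exact: (big_morph f fM (morph_one fM)). Qed.

Lemma morph_commute x y : commute x y -> commute (f x) (f y).
Proof. by rewrite /commute -!fM => ->. Qed.

End Morphism.

Lemma morph_iter (G : groupType) (f : G -> G) n :
  {morph f : x y / (x * y)%g} -> {morph iter n f : x y / (x * y)%g}.
Proof. by move=> fM; elim: n => // n IHn x y /=; rewrite IHn fM. Qed.

(** * From a commuting window with a relation to a commuting orbit *)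

Section CommutingOrbit.
Local Open Scope group_scope.
Variables (K : groupType) (phi : K -> K).
Hypothesis phiM : {morph phi : x y / x * y}.
Variable x : K.
Let X i := iter i phi x.

Let XD i j : iter j phi (X i) = X (j + i). Proof. by rewrite /X iterD. Qed.

Let commuteD k i j : commute (X i) (X j) -> commute (X (k + i)) (X (k + j)).
Proof. by rewrite -!XD; apply: morph_commute; exact: morph_iter. Qed.

Variables (d : nat) (c : {poly int}).
Hypotheses (X_comm : forall i, (i <= d)%N -> commute x (X i))
  (cd : (size c <= d.+1)%N)
  (c_rel : \prod_(0 <= i < d.+1) zpowg (X i) (c`_i)%R = 1).

Let X_window i j : (j <= d)%N -> commute (X i) (X (i + j)).
Proof. by move=> jd; have := @commuteD i 0 j (X_comm jd); rewrite addn0. Qed.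

(** The relation may be raised to the power e factor by factor, since X_0, ..., X_d commute
    pairwise; then phi^k is applied. *)
Let rel_shift e k : \prod_(0 <= i < d.+1) zpowg (X (k + i) ^+ e) (c`_i)%R = 1.
Proof.
rewrite -[RHS](morph_one (morph_iter k phiM)) -[in RHS](expg1n _ e) -[in RHS]c_rel.
rewrite -zpowg_nat zpowg_prod_nat => [|i j id jd].
  rewrite morph_prod_nat; last exact: morph_iter.
  apply: eq_bigr => i _; rewrite zpowg_nat zpowgX morph_zpow; last exact: morph_iter.
  by rewrite morphX ?XD //; exact: morph_iter.
apply/commute_zpowg/commute_sym/commute_zpowg.
wlog ij : i j id jd / (i <= j)%N => [hw|].
  by case/orP: (leq_total i j) => /hw; [apply | move=> /(_ jd id)/commute_sym; apply].
apply: commute_sym; rewrite -(subnKC ij); apply: X_window.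
exact: leq_ltn_trans (leq_subr _ _) jd.
Qed.

Lemma top_index (P : pred nat) i : P i -> (i <= d)%N ->
  exists k, [/\ P k, (k <= d)%N & forall j, (k < j <= d)%N -> ~~ P j].
Proof.
move=> Pi id; have exP : exists k, P k && (k <= d)%N by exists i; rewrite Pi.
have ubP k : P k && (k <= d)%N -> (k <= d)%N by case/andP.
case: (ex_maxnP exP ubP) => k /andP[Pk kd] kmax; exists k; split=> // j /andP[kj jd].
by apply/negP => Pj; have := kmax j; rewrite Pj jd leqNgt kj => /(_ isT).
Qed.

(** Induction on j. If c_k is the last non-zero coefficient, the relation shifted by j - k expresses
    X_j^(N c_k) through N-th powers of earlier X_i, so N is replaced by N |c_k|. At this stage N may
    grow with j. *)
Lemma orbit_powers_commute : c != 0%R -> forall j,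
  exists2 N, (0 < N)%N & forall i, (i < j)%N -> commute x (X i ^+ N).
Proof.
move=> c0; elim=> [|j [N N0 IHj]]; first by exists 1%N.
have [jd|dj] := leqP j d.
  exists 1%N => // i ij; rewrite expg1; apply: X_comm; exact: leq_trans jd.
have clast : (c`_(size c).-1 != 0)%R by rewrite -lead_coefE lead_coef_eq0.
have [|k [ck kd kmax]] := @top_index (fun i => (c`_i != 0)%R) _ clast.
  by rewrite -ltnS prednK // size_poly_gt0.
have kj : (k <= j)%N by rewrite (leq_trans kd) // ltnW.
exists (N * `|(c`_k)%R|)%N; first by rewrite muln_gt0 N0 absz_gt0.
move=> i; rewrite ltnS leq_eqVlt => /predU1P[-> |ij]; last first.
  by rewrite expgnA; apply: commuteX; exact: IHj.
have := commute_prod_term (n := d.+1) (k := k) kd (rel_shift N (j - k)) (x := x).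
rewrite subnK // => H; rewrite expgnA -(zpowg_nat (X j ^+ N)).
suff cm : commute x (zpowg (X j ^+ N) (c`_k)%R).
  by have [->|->] := zpowg_abs (X j ^+ N) (c`_k)%R => //; exact: commuteV.
apply: H => i' i'd; rewrite neq_ltn => /orP[i'k|ki'].
  by apply: commute_zpowg; apply: IHj; rewrite -ltn_subRL subKn.
by have := kmax i'; rewrite ki' => /(_ i'd)/negPn/eqP->; exact: commute1.
Qed.

(* If k is the top index with l not dividing c_k, the relation shifted by j - k
   writes X_j^((N/l) c_k) in terms of earlier X_i^(N/l) and of N-th powers. *)
Lemma orbit_commute_div N l : prime l -> ~~ (l%:Z %| zcontents c)%Z -> (l %| N)%N ->
  (forall j, commute x (X j ^+ N)) -> forall j, commute x (X j ^+ (N %/ l)).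
Proof.
move=> l_pr lc lN xN; set e := (N %/ l)%N.
have NE : N = (e * l)%N by rewrite divnK.
elim/ltn_ind => j IHj.
have [jd|dj] := leqP j d; first by apply: commuteX; exact: X_comm.
have [i ci] : exists i, ~~ (l%:Z %| (c`_i)%R)%Z.
  apply: contrapT => nex; case/negP: lc; rewrite dvdz_contents;
    apply/(all_nthP 0%R) => i _.
  by apply: contrapT => /negP ci; apply: nex; exists i.
have id : (i <= d)%N.
  rewrite leqNgt; apply/negP => di; case/negP: ci.
  by rewrite nth_default ?dvdz0 // (leq_trans cd).
have [k [ck kd kmax]] := @top_index (fun i => ~~ (l%:Z %| (c`_i)%R)%Z) _ ci id.
have kj : (k <= j)%N by rewrite (leq_trans kd) // ltnW.
have cm : commute x (zpowg (X j ^+ e) (c`_k)%R).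
  have := commute_prod_term (n := d.+1) (k := k) kd (rel_shift e (j - k)) (x := x).
  rewrite subnK // => H; apply: H => i' i'd; rewrite neq_ltn => /orP[i'k|ki'].
    by apply: commute_zpowg; apply: IHj; rewrite -ltn_subRL subKn.
  have := kmax i'; rewrite ki' => /(_ i'd)/negPn/dvdzP[q ->].
  rewrite mulrC zpowgM zpowg_nat -expgnA -NE; apply: commute_zpowg; exact: xN.
(* Bezout for c_k and l: X_j^e is a product of a power of X_j^(e c_k) and a power of X_j^(e l) =
   X_j^N, both commuting with x. *)
have [[u v] /= uv] : exists uv : int * int, (uv.1 * (c`_k)%R + uv.2 * l%:Z = 1)%R.
  have /coprimezP[[u v] uv] : coprimez (c`_k)%R l%:Z; last by exists (u, v).
  by rewrite coprimez_sym coprimezE prime_coprime // -dvdzE.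
rewrite -[X j ^+ e]zpowg1 -uv zpowgD mulrC [(v * _)%R]mulrC !zpowgM; apply: commuteM.
  exact: commute_zpowg.
by rewrite zpowg_nat -expgnA -NE; apply: commute_zpowg; exact: xN.
Qed.

Hypothesis c_prim : zcontents c = 1%R.

(** No prime divides the content 1 of c, so the prime factors of N can be removed one after the
    other. *)
Lemma orbit_powers_descent N : (0 < N)%N ->
  (forall j, commute x (X j ^+ N)) -> forall j, commute x (X j).
Proof.
elim/ltn_ind: N => N IHN N0 xN.
have [N1|N1] := leqP N 1; first by have NE : N = 1%N; [lia | rewrite NE in xN].
have l_pr := pdiv_prime N1.
apply: (IHN (N %/ pdiv N)%N); last apply: orbit_commute_div => //.
- by rewrite ltn_Pdiv // prime_gt1.
- by rewrite divn_gt0 ?pdiv_gt0 // dvdn_leq ?pdiv_dvd.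
- by rewrite c_prim dvdz1 absz_nat neq_ltn prime_gt1 ?orbT.
- exact: pdiv_dvd.
Qed.

(* The coincidence puts x into every window <X_(j+1), ..., X_(j+m)>, whence a single
   N for which all X_j^N commute with x; the primitivity of c brings N down to 1. *)
Lemma orbit_commute m n :
  word_ball [set X i | i in [set i | (0 < i <= m)%N]]%classic n x ->
  forall i j, commute (X i) (X j).
Proof.
set S := fun j => [set X i | i in [set i | (j < i <= j + m)%N]]%classic => coll.
(* Moving the window from j to j + 1 loses only X_(j+1). The coincidence, shifted by j + 1, rewrites
   it as a word of length at most n in the new window; the factor n + 1 covers both kinds of
   generators. *)
have S_shift j g k : word_ball (S j) k g -> exists k', word_ball (S j.+1) k' g.
  move=> Sg; exists ((n + 1) * k)%N.
  apply: word_ball_trans Sg => _ [i /= /andP[ji ijm] <-].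
  have [e|ne] := eqVneq i j.+1; last first.
    apply: word_ballW (word_ball_gen _); first by rewrite addn1.
    by exists i => //=; rewrite addSn ltn_neqAle eq_sym ne ji leqW.
  have -> : X i = iter j.+1 phi x by rewrite e.
  have : (iter j.+1 phi @` word_ball (S 0%N) n)%classic (iter j.+1 phi x).
    by exists x.
  rewrite -word_ball_image; last exact: morph_iter.
  move/(word_ball_trans (c := 1)) => H; apply: (word_ballW _ (H _ _)).
    by rewrite mul1n leq_addr.
  move=> _ [_ [i' /= i'm <-] <-].
  apply: word_ball_gen; exists (j.+1 + i')%N; last by rewrite XD.
  by move: i'm; rewrite /=; lia.
have S_all j : exists k, word_ball (S j) k x.
  by elim: j => [|j [k /S_shift //]]; exists n.
have [c0|c0] := eqVneq c 0%R.
  by move: c_prim; rewrite c0 zcontents0.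
have [N N0 xN] := orbit_powers_commute c0 m.+1.
have xX : forall j, commute x (X j).
  apply: (orbit_powers_descent N0) => j.
  have [jm|mj] := leqP j m; first exact: xN.
  (* For j > m, x is a word in X_(j-m+1), ..., X_j. Each such X_i commutes with X_j^N because j - i
     < m, so one N serves all j. *)
  have [k] := S_all (j - m)%N; rewrite /S subnK ?(ltnW mj) // => Sx.
  apply/commute_sym; apply: commute_word_ball Sx => _ [i /= /andP[ji ij] <-].
  have := morph_commute (morph_iter i phiM) (xN (j - i)%N _).
  rewrite morphX; last exact: morph_iter.
  rewrite XD subnKC // => H; apply/commute_sym/H.
  by lia.
move=> i j; wlog ij : i j / (i <= j)%N => [hw|].
  by case/orP: (leq_total i j) => /hw // /commute_sym.
have := @commuteD i 0 (j - i) (xX _); by rewrite addn0 subnKC.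
Qed.

End CommutingOrbit.

(** * Integer polynomials with small roots *)

Section Kronecker.
Implicit Types (p q : {poly int}) (rs : seq algC).

Local Notation pC := (map_poly (intr : int -> algC)).

(* Graeffe's transform of p is, up to sign, p(X) p(-X) as a polynomial in X^2. *)
Lemma graeffe rs p : pC p = \prod_(z <- rs) ('X - z%:P) ->
  exists q, pC q = \prod_(z <- rs) ('X - (z ^+ 2)%:P).
Proof.
move=> prs; set e := even_poly p; set o := odd_poly p.
exists ((-1) ^+ size rs * (e ^+ 2 - 'X * o ^+ 2)).
(* Both sides are compared at X^2, where X^2 - z^2 factors as (X - z)(X + z). *)
suff comp2 : pC ((-1) ^+ size rs * (e ^+ 2 - 'X * o ^+ 2)) \Po 'X^2 =
    (\prod_(z <- rs) ('X - (z ^+ 2)%:P)) \Po 'X^2.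
  apply/polyP => i; have := congr1 (fun f : {poly algC} => f`_(i * 2)) comp2.
  by rewrite !coef_comp_poly_Xn // dvdn_mull // mulnK.
have pE : pC p = (pC e \Po 'X^2) + (pC o \Po 'X^2) * 'X.
  rewrite -{1}(poly_even_odd p) rmorphD rmorphM /= !map_comp_poly.
  by rewrite map_polyX map_polyXn.
have pN : pC p \Po (- 'X) = (pC e \Po 'X^2) - (pC o \Po 'X^2) * 'X.
  rewrite pE rmorphD rmorphM /= -!comp_polyA comp_polyX rmorphXn /= comp_polyX.
  by rewrite sqrrN mulrN.
have -> : (\prod_(z <- rs) ('X - (z ^+ 2)%:P)) \Po 'X^2 =
    (-1) ^+ size rs * (pC p * (pC p \Po - 'X)).
  rewrite prs !rmorph_prod /= -big_split /=.
  elim: rs {prs pE pN} => [|z rs IHrs]; first by rewrite !big_nil /= expr0 mul1r.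
  rewrite !big_cons IHrs /= [(-1) ^+ _.+1]exprS !rmorphB /=.
  by rewrite !comp_polyC !comp_polyX polyC_exp /=; ring.
have -> : pC ((-1) ^+ size rs * (e ^+ 2 - 'X * o ^+ 2)) =
    (-1) ^+ size rs * (pC e ^+ 2 - 'X * pC o ^+ 2).
  by rewrite !(rmorphM, rmorphB, rmorphXn, rmorphN1) /= map_polyX.
rewrite pN pE; rewrite !(rmorphM, rmorphB, rmorphXn, rmorphN1) /= comp_polyX; ring.
Qed.

Lemma graeffe_iter rs p j : pC p = \prod_(z <- rs) ('X - z%:P) ->
  exists q, pC q = \prod_(z <- rs) ('X - (z ^+ (2 ^ j))%:P).
Proof.
move=> prs; elim: j => [|j [q qE]]; first by exists p; under eq_bigr do rewrite expr1.
have [|r rE] := @graeffe [seq z ^+ (2 ^ j) | z <- rs] q; first by rewrite big_map.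
by exists r; rewrite rE big_map; under eq_bigr do rewrite -exprM -expnSr.
Qed.

(** A factor X - z with |z| <= 2 multiplies a bound on the coefficients by at most 1 + 2. *)
Lemma coef_prod_XsubC_bound rs i : (forall z, z \in rs -> `|z| <= 2) ->
  `|(\prod_(z <- rs) ('X - z%:P))`_i| <= 3 ^+ size rs.
Proof.
elim: rs i => [|z rs IHrs] i zb.
  by rewrite big_nil coef1 /=; case: (i == 0%N); rewrite ?normr1 ?normr0.
have b j : `|(\prod_(y <- rs) ('X - y%:P))`_j| <= 3 ^+ size rs.
  by apply: IHrs => y yrs; apply: zb; rewrite inE yrs orbT.
rewrite big_cons mulrBl coefB coefXM coefCM (le_trans (ler_normB _ _)) //= exprS.
rewrite (_ : 3 * _ = 3 ^+ size rs + 2 * 3 ^+ size rs); last by ring.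
apply: lerD; first by case: (i == 0%N); rewrite ?normr0 ?exprn_ge0.
by rewrite normrM ler_pM // zb // mem_head.
Qed.

(** A coefficient between -M and M is coded by its sum with M, whence [M.*2.+1] values. *)
Definition bounded_polys (d M : nat) : seq {poly int} :=
  [seq \poly_(i < d.+1) ((f (inord i) : nat)%:Z - M%:Z)
     | f : {ffun 'I_d.+1 -> 'I_(M.*2.+1)}].

Lemma mem_bounded_polys d M p : (size p <= d.+1)%N ->
  (forall i, `|p`_i| <= M%:Z) -> p \in bounded_polys d M.
Proof.
move=> sp pM; apply/fintype.imageP => /=.
exists [ffun i : 'I_d.+1 => inord (absz (p`_i + M%:Z))] => //.
apply/polyP => i; rewrite coef_poly; case: ltnP => [id|di];
  last by rewrite nth_default // (leq_trans sp).
by have := pM i; rewrite ffunE (inordK id); move: (p`_i) => a a_M; rewrite inordK; lia.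
Qed.

Definition complex_roots p : seq algC :=
  sval (closed_field_poly_normal (pC p)).

(** For M = 3^d the length of this list depends on d alone; it bounds the number of squarings, hence
    the strides 2^j to be tried. *)
Definition bounded_roots d M := flatten (map complex_roots (bounded_polys d M)).

(* The iterated squares z^(2^j) of a root of p are roots of monic integer
   polynomials of degree at most d and coefficients at most 3^d, so they lie in a
   finite set depending only on d. *)
Lemma kronecker d p (z : algC) (J := size (bounded_roots d (3 ^ d))) :
  p \is monic -> (size p <= d.+1)%N -> root (pC p) z ->
  (forall y j, root (pC p) y -> (j <= J)%N -> `|y ^+ (2 ^ j)| <= 2) ->
  exists i j, (i < j)%N /\ z ^+ (2 ^ i) = z ^+ (2 ^ j).
Proof.
move=> p_mon sp pz pb; have [rs pE] := closed_field_poly_normal (pC p).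
have pC_mon : pC p \is monic by apply: monic_map.
move: pE; rewrite (monicP pC_mon) scale1r => pE.
have srs : (size rs <= d)%N.
  by rewrite -ltnS -(size_prod_XsubC _ id) -pE size_map_inj_poly //; exact: intr_inj.
have root_rs y : root (pC p) y = (y \in rs) by rewrite pE root_prod_XsubC.
have prodE j : \prod_(y <- rs) ('X - (y ^+ (2 ^ j))%:P) =
  \prod_(y <- [seq y ^+ (2 ^ j) | y <- rs]) ('X - y%:P) by rewrite big_map.
have memJ j : (j <= J)%N -> z ^+ (2 ^ j) \in bounded_roots d (3 ^ d).
  move=> jJ; have [q qE] := graeffe_iter j pE.
  apply/flatten_mapP; exists q.
    apply: mem_bounded_polys => [|i].
      rewrite -(@size_map_inj_poly _ _ (intr : int -> algC)) //; last exact: intr_inj.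
      by rewrite qE prodE size_prod_XsubC size_map.
    rewrite -(ler_int algC) intr_norm -[(_`_i)%:~R](coef_map (intr : int -> algC)).
    rewrite qE prodE.
    apply: le_trans (coef_prod_XsubC_bound _ _) _ => [y /mapP[y' y'rs ->]|].
      by apply: pb => //; rewrite root_rs.
    by rewrite size_map -natrX -[(3 ^ d)%:Z%:~R]/((3 ^ d)%:R) ler_nat leq_pexp2l.
  rewrite /complex_roots; case: closed_field_poly_normal => /= qs qsE.
  have : root (pC q) (z ^+ (2 ^ j)).
    rewrite qE prodE root_prod_XsubC.
    by apply/mapP; exists z; rewrite -?root_rs.
  rewrite qsE rootZ ?root_prod_XsubC // lead_coef_eq0 qE.
  by rewrite prodE monic_neq0 ?monic_prod_XsubC.
(* Pigeonhole: the J + 1 values z^(2^j) with j <= J lie in a list of length J. *)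
have : ~~ uniq [seq z ^+ (2 ^ j) | j <- iota 0 J.+1].
  apply/negP => /uniq_leq_size sub.
  have : (J.+1 <= J)%N; last by rewrite ltnn.
  rewrite -[X in (X <= _)%N](size_iota 0) -(size_map (fun j => z ^+ (2 ^ j))); apply: sub.
  by move=> _ /mapP[j jJ ->]; apply: memJ; move: jJ; rewrite mem_iota.
move/(uniqPn 0) => [i [j [ij]]]; rewrite size_map size_iota => jJ.
rewrite !(nth_map 0%N) ?size_iota ?(ltn_trans ij) //.
by rewrite !nth_iota ?(ltn_trans ij) // => eqz; exists i, j.
Qed.

(** The leading coefficient is 1 or -1, and for |z| > 2 the sum of the |z|^i with i < n stays below
    |z|^n, so the lower terms cannot cancel the leading one. *)
Lemma root_sign_poly_bound (g : {poly int}) (z : algC) : g != 0 ->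
  (forall i, `|g`_i| <= 1) -> root (pC g) z -> `|z| <= 2.
Proof.
move=> g0 gb gz; rewrite real_leNgt ?normr_real //; apply/negP => z2.
have [n sg] : exists n, size g = n.+1 by exists (size g).-1;
  rewrite prednK // size_poly_gt0.
have lg : `|(g`_n)%:~R : algC| = 1.
  rewrite -intr_norm; have := gb n; have : g`_n != 0.
    by rewrite -[n]/(n.+1.-1) -sg -lead_coefE lead_coef_eq0.
  by move=> ? ?; have -> : `|g`_n| = 1 by lia.
have hz : \sum_(i < n.+1) (g`_i)%:~R * z ^+ i = 0.
  have := rootP gz; rewrite horner_coef size_map_inj_poly //; last exact: intr_inj.
  by rewrite sg; under eq_bigr do rewrite coef_map.
have : `|z| ^+ n = `|\sum_(i < n) (g`_i)%:~R * z ^+ i|.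
  move: hz; rewrite big_ord_recr /= => /eqP; rewrite addr_eq0 => /eqP->.
  by rewrite normrN normrM lg mul1r normrX.
apply/eqP; rewrite gt_eqF //; apply: le_lt_trans (ler_norm_sum _ _ _) _.
apply: (@le_lt_trans _ _ (\sum_(i < n) `|z| ^+ i)).
  apply: ler_sum => i _; rewrite normrM normrX -[leRHS]mul1r.
  rewrite ler_wpM2r ?exprn_ge0 //.
  by rewrite -intr_norm -[1]/(1%:~R) ler_int.
elim: n {sg lg hz} => [|n IHn]; first by rewrite big_ord0 expr0.
rewrite big_ord_recr /=; apply: (@lt_le_trans _ _ (`|z| ^+ n + `|z| ^+ n));
  first by rewrite ltrD2r.
by rewrite exprS -mulr2n -mulr_natl ler_wpM2r ?exprn_ge0 // ltW.
Qed.

End Kronecker.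

(** * Coincidences between binary words *)

Section BinaryWords.
Local Open Scope group_scope.
Variables (K : groupType) (phi : K -> K) (x : K).

(** For a morphism [phi] this is x_0^e_0 x_s^e_1 x_2s^e_2 ..., with x_i = phi^i(x), in Horner
    form. *)
Fixpoint binary_word (s : nat) (w : seq bool) : K :=
  if w is b :: w' then x ^+ b * iter s phi (binary_word s w') else 1.

Hypotheses (phiM : {morph phi : x y / x * y}) (phi_inj : injective phi).

Lemma binary_word_ball m i w : (0 < i)%N -> (i + size w <= m.+1)%N ->
  word_ball [set iter j phi x | j in [set j | (0 < j <= m)%N]]%classic (size w)
    (iter i phi (binary_word 1 w)).
Proof.
elim: w i => [|b w IHw] i i0 iw /=.
  by rewrite (morph_one (morph_iter i phiM)); exact: word_ball_id.
rewrite morph_iter // -iterSr; apply: (@word_ballM _ _ 1 (size w)); last first.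
  by apply: IHw; move: iw => /=; lia.
case: b iw => iw; last by rewrite expg0 (morph_one (morph_iter i phiM));
  apply: word_ballW (word_ball_id _).
by rewrite expg1; apply: word_ball_gen; exists i => //=; move: iw => /=; lia.
Qed.

(** A common prefix cancels by injectivity of [phi]. At the first differing letter the equation can
    be solved for x as a quotient of two tails, which involve only x_1, ..., x_m. *)
Lemma binary_word_collision v w : size v = size w -> v <> w ->
  binary_word 1 v = binary_word 1 w ->
  exists m n,
    word_ball [set iter j phi x | j in [set j | (0 < j <= m)%N]]%classic n x.
Proof.
elim: v w => [|b v IHv] [|b' w] //= [svw] vw evw.
have ball u : size u = size v ->
  word_ball [set iter j phi x | j in [set j | (0 < j <= size v)%N]]%classic (size v)
    (phi (binary_word 1 u)).
  by move=> su; have := @binary_word_ball (size v) 1 u; rewrite su; apply.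
have [bb|bb] := eqVneq b b'.
  apply: (IHv w svw) => [vw'|]; first by apply: vw; rewrite bb vw'.
  by move: evw; rewrite bb => /mulgI/phi_inj.
exists (size v), (size v + size v)%N.
case: b b' {vw} evw bb => [] [] //=; rewrite expg0 expg1 mul1g => evw _.
  rewrite [X in word_ball _ _ X](_ :
    x = phi (binary_word 1 w) / phi (binary_word 1 v)).
    by apply: word_ballM; [apply: ball | apply/word_ballV/ball].
  by rewrite -evw mulgK.
rewrite [X in word_ball _ _ X](_ : x = phi (binary_word 1 v) / phi (binary_word 1 w)).
  by apply: word_ballM; [apply: ball | apply/word_ballV/ball].
by rewrite evw mulgK.
Qed.

End BinaryWords.

(** * The module over Z[X] generated by x *)

Section PolynomialAction.
Local Open Scope group_scope.
Variables (K : groupType) (phi : K -> K).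
Hypotheses (K_tf : torsion_free K) (phiM : {morph phi : x y / x * y})
  (phi_inj : injective phi).
Variable x : K.
Hypothesis X_comm : forall i j, commute (iter i phi x) (iter j phi x).
Implicit Types f g h : {poly int}.

(** This is f applied to x, in multiplicative notation, X acting as [phi]. *)
Definition orbit_act f : K :=
  \prod_(0 <= i < size f) zpowg (iter i phi x) (f`_i)%R.

Lemma orbit_actE n f : (size f <= n)%N ->
  orbit_act f = \prod_(0 <= i < n) zpowg (iter i phi x) (f`_i)%R.
Proof.
move=> fn; rewrite [RHS](@big_cat_nat _ _ _ (size f)) //=.
rewrite [X in _ * X]big1_seq ?mulg1 // => i.
by rewrite mem_index_iota => /andP[_ /andP[fi _]]; rewrite nth_default.
Qed.

Let zX_comm i j (a b : int) :
  commute (zpowg (iter i phi x) a) (zpowg (iter j phi x) b).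
Proof. exact/commute_zpowg/commute_sym/commute_zpowg. Qed.

Lemma orbit_actD f g : orbit_act (f + g)%R = orbit_act f * orbit_act g.
Proof.
rewrite !(@orbit_actE (maxn (size f) (size g))) ?size_polyD ?leq_maxl ?leq_maxr //.
rewrite -prodM_nat //; apply: eq_bigr => i _; by rewrite coefD zpowgD.
Qed.

Lemma orbit_actZ a f : orbit_act (a *: f)%R = zpowg (orbit_act f) a.
Proof.
rewrite (orbit_actE (size_scale_leq a f)) /orbit_act zpowg_prod_nat //.
by apply: eq_bigr => i _; rewrite coefZ mulrC zpowgM.
Qed.

Lemma orbit_actX f : orbit_act ('X * f)%R = phi (orbit_act f).
Proof.
have sX : (size ('X * f)%R <= (size f).+1)%N.
  by have := size_polyMleq 'X%R f; rewrite size_polyX.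
rewrite (orbit_actE sX) /orbit_act big_nat_recl // coefXM eqxx zpowg0 mul1g.
rewrite (morph_prod_nat phiM); apply: eq_bigr => i _.
by rewrite coefXM (morph_zpow phiM).
Qed.

Lemma orbit_actXn n f : orbit_act ('X^n * f)%R = iter n phi (orbit_act f).
Proof.
elim: n => [|n IHn]; first by rewrite expr0 mul1r.
by rewrite exprS -mulrA orbit_actX IHn.
Qed.

Lemma orbit_actC a : orbit_act a%:P%R = zpowg x a.
Proof. by rewrite (@orbit_actE 1) ?size_polyC_leq1 // big_nat1 coefC. Qed.

Lemma orbit_act0 : orbit_act 0%R = 1.
Proof. by rewrite /orbit_act size_poly0 big_nil. Qed.

Lemma orbit_act_ideal f g : orbit_act f = 1 -> orbit_act (g * f)%R = 1.
Proof.
move=> f1; elim/poly_ind: g => [|g c IHg]; first by rewrite mul0r orbit_act0.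
rewrite mulrDl orbit_actD mul_polyC orbit_actZ f1 zpowg1n mulg1.
by rewrite [(g * _)%R]mulrC -mulrA orbit_actX IHg (morph_one phiM).
Qed.

(** Non-zero integer factors cancel, so divisibility up to constants is enough in what follows. *)
Lemma orbit_act_tors a f : a != 0%R -> orbit_act (a *: f)%R = 1 -> orbit_act f = 1.
Proof. by move=> a0; rewrite orbit_actZ; exact: zpowg_eq1. Qed.

Definition word_poly (w : seq bool) : {poly int} :=
  Poly [seq (b : nat)%:Z | b : bool <- w].

Lemma orbit_act_word s w :
  orbit_act (word_poly w \Po 'X^s)%R = binary_word phi x s w.
Proof.
elim: w => [|b w IHw] /=; first by rewrite comp_poly0 orbit_act0.
rewrite /word_poly /= cons_poly_def -/(word_poly w) rmorphD rmorphM /=.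
rewrite comp_polyX comp_polyC -IHw addrC orbit_actD.
by rewrite orbit_actC zpowg_nat mulrC orbit_actXn.
Qed.

Hypothesis phi_free : forall r y, (0 < r)%N -> iter r phi y = y -> y = 1.
Hypothesis x1 : x <> 1.

(** A non-zero annihilator of least size is replaced by its primitive part, which still annihilates
    x because K is torsion-free. *)
Lemma orbit_minimal_poly f : f != 0%R -> orbit_act f = 1 ->
  exists p, [/\ zprimitive p = p, p != 0%R, orbit_act p = 1, (size p <= size f)%N &
    forall g, (size g < size p)%N -> orbit_act g = 1 -> g = 0%R].
Proof.
move=> f0 f1.
pose P n := `[< exists g, [/\ g != 0%R, orbit_act g = 1 & size g = n] >].
have exP : exists n, P n by exists (size f); apply/asboolP; exists f.
case: (ex_minnP exP) => n /asboolP[p [p0 p1 sp]] nmin; exists (zprimitive p); split.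
- by rewrite zprimitive_id.
- by rewrite zprimitive_eq0.
- apply: (@orbit_act_tors (zcontents p)); first by rewrite zcontents_eq0.
  by rewrite -zpolyEprim.
- by rewrite size_zprimitive sp; apply: nmin; apply/asboolP; exists f.
move=> g; rewrite size_zprimitive sp => gn g1; apply: contrapT => /eqP g0.
by have := nmin (size g); rewrite leqNgt gn => H; apply/notF/H/asboolP; exists g.
Qed.

Section MinimalPolynomial.
Variable p : {poly int}.
Hypotheses (p_prim : zprimitive p = p) (p0 : p != 0%R) (p1 : orbit_act p = 1)
  (p_min : forall g, (size g < size p)%N -> orbit_act g = 1 -> g = 0%R).

Local Notation pC := (map_poly (intr : int -> algC)).

(** The remainder of the pseudo-division by p annihilates x and is smaller than p, hence 0.
    Divisibility here is up to a non-zero constant. *)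
Lemma orbit_minimal_dvd f : orbit_act f = 1 -> (p %| f)%R.
Proof.
move=> f1; rewrite /dvdp; apply/eqP; apply: p_min; first by rewrite ltn_modp.
have /(congr1 orbit_act) := Pdiv.Idomain.divp_eq f p.
by rewrite orbit_actD orbit_actZ f1 zpowg1n orbit_act_ideal // mul1g.
Qed.

Lemma orbit_minimal_size : (1 < size p)%N.
Proof.
rewrite ltn_neqAle eq_sym size_poly_gt0 p0 andbT; apply/negP => /eqP sp.
have := p1; rewrite (size1_polyC (eq_leq sp)) orbit_actC => /zpowg_eq1 H;
  apply/x1/H => //.
by apply: contraNneq p0 => p00; rewrite (size1_polyC (eq_leq sp)) p00.
Qed.

(** Otherwise p = X q, and injectivity of [phi] makes the smaller q annihilate x. *)
Lemma orbit_minimal_root0 : ~~ root (pC p) 0%R.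
Proof.
rewrite rootE horner_coef0 coef_map /= intr_eq0; apply/negP => /eqP p00.
have [q pE] : exists q, p = ('X * q)%R.
  exists (drop_poly 1 p); rewrite mulrC -[LHS](poly_take_drop 1) expr1 -[RHS]add0r;
    congr (_ + _)%R.
  by apply/polyP => -[|i]; rewrite coef_take_poly coef0 //=.
have q0 : q = 0%R.
  apply: p_min.
    rewrite pE mulrC size_mulX //; move: p0.
    by rewrite pE mulf_eq0 polyX_eq0.
  by apply: phi_inj; rewrite -orbit_actX -pE p1 (morph_one phiM).
by case/eqP: p0; rewrite pE q0 mulr0.
Qed.

(** Otherwise gcd(p, X^r - 1) is not constant, and its cofactor h in p is too small to annihilate x.
    Up to a constant, p divides (X^r - 1) h, so h applied to x is a non-trivial fixed point of
    phi^r. *)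
Lemma orbit_minimal_root_unity (z : algC) r :
  (0 < r)%N -> root (pC p) z -> (z ^+ r <> 1)%R.
Proof.
move=> r0 pz zr; set f : {poly int} := ('X^r - 1)%R.
have sf : size f = r.+1 by rewrite size_XnsubC.
(* The resultant is a combination of p and f with polynomial coefficients, so evaluation at the
   common root z shows that it is 0. *)
have sg : (1 < size (gcdp p f))%N.
  rewrite -resultant_eq0; have [||[u v] /= _ uvE] := @resultant_in_ideal _ p f.
  - exact: orbit_minimal_size.
  - by rewrite sf.
  have := congr1 (fun g => (pC g).[z])%R uvE.
  rewrite map_polyC /= hornerC rmorphD !rmorphM /= hornerD !hornerM (rootP pz).
  rewrite mulr0 add0r.
  rewrite /f rmorphB rmorph1 /= map_polyXn hornerD hornerXn hornerN hornerC zr.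
  by rewrite subrr mulr0; move/eqP; rewrite intr_eq0.
have [[k h] /= k0 ph] := Pdiv.Idomain.dvdpP _ _ (dvdp_gcdl p f).
have [[l h'] /= l0 fh] := Pdiv.Idomain.dvdpP _ _ (dvdp_gcdr p f).
have g0 : gcdp p f != 0%R by rewrite -size_poly_gt0 (ltn_trans _ sg).
have h0 : h != 0%R.
  by apply: contraNneq p0 => h0; move/eqP: ph;
    rewrite h0 mul0r -mul_polyC mulf_eq0 polyC_eq0 (negPf k0).
have y1 : orbit_act h <> 1.
  move/p_min => hE; case/eqP: (h0); apply: hE.
  have := size_scale p k0; rewrite ph size_mul // => <-.
  by move: sg; case: (size (gcdp p f)) => [|[|n]] // _; rewrite !addnS /= ltnS leq_addr.
apply/y1/(phi_free r0); rewrite -orbit_actXn.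
have fh1 : orbit_act (f * h)%R = 1.
  apply: (orbit_act_tors l0); rewrite scalerAl fh -mulrA; apply: orbit_act_ideal.
  by rewrite mulrC -ph orbit_actZ p1 zpowg1n.
by rewrite -[('X^r)%R](subrK 1%R) mulrDl mul1r orbit_actD fh1 mul1g.
Qed.

Lemma orbit_minimal_words d (J := size (bounded_roots d (3 ^ d))) :
  (size p <= d.+1)%N ->
  exists2 j, (j <= J)%N & forall v w, size v = size w ->
    binary_word phi x (2 ^ j) v = binary_word phi x (2 ^ j) w -> v = w.
Proof.
move=> sp; apply: contrapT => nex.
(* A coincidence at stride 2^j gives g as the difference of two word polynomials, with coefficients
   in {-1, 0, 1}. *)
have coll j : (j <= J)%N -> exists g : {poly int},
    [/\ g != 0%R, (forall i, (`|g`_i| <= 1)%R) &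
    orbit_act (g \Po 'X^(2 ^ j))%R = 1].
  move=> jJ; apply: contrapT => ng; apply: nex; exists j => // v w svw vw;
    apply: contrapT => nvw.
  apply: ng; exists (word_poly v - word_poly w)%R; split.
  - apply/eqP => /subr0_eq vw0; apply: nvw.
    apply: (@eq_from_nth _ false _ _ svw) => i iv;
      have := congr1 (fun g : {poly int} => (g`_i)%R) vw0.
    by rewrite /= !coef_Poly !(nth_map false) // -?svw //;
      move: (nth false v i) (nth false w i) => [] [].
  - move=> i; rewrite coefB !coef_Poly.
    have b u : exists b : bool, ([seq (b : nat)%:Z | b : bool <- u]`_i = b%:Z)%R.
      have [iu|ui] := ltnP i (size u); first by exists (nth false u i);
        rewrite (nth_map false).
      by exists false; rewrite nth_default // size_map.
    by have [b1 ->] := b v; have [b2 ->] := b w; case: b1; case: b2.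
  - rewrite rmorphB /= orbit_actD orbit_act_word vw -orbit_act_word -orbit_actD.
    by rewrite addrN orbit_act0.
(* Stride 1: by primitivity p divides g exactly, so its leading coefficient divides 1 or -1;
   [zprimitive] makes it positive. *)
have p_monic : p \is monic.
  have [g [g0 gb]] := coll 0%N isT.
  rewrite comp_polyXr => /orbit_minimal_dvd/dvdpP_int[r gE].
  have := sgz_lead_primitive p; have := gb (size g).-1; rewrite -lead_coefE.
  move: g0; rewrite -lead_coef_eq0 gE p_prim lead_coefM (negPf p0) monicE /=.
  move: (lead_coef p) (lead_coef r) => a b.
  by rewrite mulf_eq0 normrM; case: sgzP; nia.
have [z pz] : exists z, root (pC p) z.
  apply/closed_rootP; rewrite size_map_inj_poly //; last exact: intr_inj.
  by rewrite gtn_eqF // orbit_minimal_size.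
have [|i [j [ij zij]]] := kronecker p_monic sp pz.
  (* A root y of p is a root of g(X^(2^j)), so y^(2^j) is a root of g. *)
  move=> y j py jJ; have [g [g0 gb /orbit_minimal_dvd g1]] := coll j jJ.
  apply: (root_sign_poly_bound g0 gb).
  have [[k h] /= k0 gE] := Pdiv.Idomain.dvdpP _ _ g1.
  have := congr1 (fun q => (pC q).[y])%R gE.
  rewrite rmorphM hornerM /= (rootP py) mulr0 linearZ /= hornerZ.
  rewrite map_comp_poly map_polyXn horner_comp hornerXn.
  by move/eqP; rewrite mulf_eq0 intr_eq0 (negPf k0) => /eqP/rootP.
have z0 : z != 0%R by apply: contraNneq orbit_minimal_root0 => <-.
apply: (@orbit_minimal_root_unity z (2 ^ j - 2 ^ i)) => //.
  by rewrite subn_gt0 ltn_exp2l.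
by rewrite expfB ?ltn_exp2l // zij divff // expf_neq0.
Qed.

End MinimalPolynomial.
End PolynomialAction.

Section Dichotomy.
Local Open Scope group_scope.
Variables (K : groupType) (phi : K -> K) (x : K).
Hypotheses (K_tf : torsion_free K) (phiM : {morph phi : x y / x * y})
  (phi_inj : injective phi) (x1 : x <> 1).
Hypothesis phi_free : forall r y, (0 < r)%N -> iter r phi y = y -> y = 1.

Lemma commuting_orbit_words d (c : {poly int})
    (J := size (bounded_roots d (3 ^ d))) :
  (forall i, (i <= d)%N -> commute x (iter i phi x)) ->
  (size c <= d.+1)%N -> c != 0%R ->
  \prod_(0 <= i < d.+1) zpowg (iter i phi x) (c`_i)%R = 1 ->
  exists2 j, (j <= J)%N & forall v w, size v = size w ->
    binary_word phi x (2 ^ j) v = binary_word phi x (2 ^ j) w -> v = w.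
Proof.
move=> xX sc c0 crel; apply: contrapT => nex.
have coll j : (j <= J)%N -> exists v w, [/\ size v = size w, v <> w &
    binary_word phi x (2 ^ j) v = binary_word phi x (2 ^ j) w].
  move=> jJ; apply: contrapT => nc; apply: nex; exists j => // v w svw vw.
  by apply: contrapT => nvw; apply: nc; exists v, w.
have XX i j : (i < d.+1)%N -> (j < d.+1)%N -> commute (iter i phi x) (iter j phi x).
  wlog ij : i j / (i <= j)%N => [hw|].
    by case/orP: (leq_total i j) => /hw // H id jd; apply/commute_sym/H.
  move=> _ jd; rewrite -(subnKC ij) iterD; apply: (morph_commute (morph_iter i phiM)).
  by apply: xX; exact: leq_ltn_trans (leq_subr _ _) jd.
(* The content can be divided out of the relation: the factors commute and K is torsion-free. *)
have prel : \prod_(0 <= i < d.+1) zpowg (iter i phi x) ((zprimitive c)`_i)%R = 1.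
  apply: (@zpowg_eq1 _ _ (zcontents c)) => //; first by rewrite zcontents_eq0.
  rewrite zpowg_prod_nat => [|i j id jd]; last first.
    by apply/commute_zpowg/commute_sym/commute_zpowg; exact: XX.
  rewrite -[RHS]crel; apply: eq_bigr => i _; rewrite -zpowgM [in RHS](zpolyEprim c) coefZ.
  by rewrite mulrC.
(* The coincidence at stride 2^0 = 1 makes the whole orbit commute; only then is the polynomial
   action available for the other strides. *)
have [v [w [svw vw evw]]] := coll 0%N isT.
have [m [n xball]] := binary_word_collision phiM phi_inj svw vw evw.
have Xcomm := orbit_commute phiM xX (c := zprimitive c) _ prel _ xball.
have {}Xcomm i j : commute (iter i phi x) (iter j phi x).
  by apply: Xcomm; rewrite ?size_zprimitive // zcontents_primitive (negPf c0).
have act_c : orbit_act phi x c = 1 by rewrite (orbit_actE _ _ sc).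
have [p [p_prim p0 p1 sp pmin]] := orbit_minimal_poly K_tf Xcomm c0 act_c.
apply/nex/(orbit_minimal_words K_tf phiM phi_inj Xcomm phi_free x1 p_prim p0 p1).
  exact: pmin.
exact: leq_trans sc.
Qed.

End Dichotomy.

(** * Relations in free abelian groups and generated subgroups *)

(** Linear dependence over the rationals, with denominators cleared. Packing the coefficients into a
    polynomial gives access to content and primitive part. *)
Lemma int_row_relation (n d : nat) (V : 'M[int]_(d.+1, n)) : (n <= d)%N ->
  exists c : {poly int}, [/\ c != 0, (size c <= d.+1)%N &
    \sum_(i < d.+1) c`_i *: row i V = 0].
Proof.
move=> nd; set M := map_mx (intr : int -> rat) V.
have : kermx M != 0.
  rewrite kermx_eq0 -row_leq_rank -ltnNge ltnS; exact: leq_trans (rank_leq_col M) nd.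
case/rowV0Pn => u /sub_kermxP uM u0; pose p := \poly_(i < d.+1) u 0 (inord i).
have [q [a a0 pE]] := rat_poly_scale p.
have p0 : p != 0.
  apply: contraNneq u0 => p0; apply/eqP/rowP => i; rewrite mxE.
  by have := congr1 (fun f : {poly rat} => f`_i) p0;
    rewrite /p coef_poly ltn_ord inord_val coef0.
have qE i : (q`_i)%:~R = a%:~R * p`_i :> rat.
  by rewrite pE coefZ mulrA divff ?intr_eq0 // mul1r coef_map.
exists q; split.
- by apply: contraNneq p0 => q0; rewrite pE q0 map_poly0 scaler0.
- by apply/leq_sizeP => i di; apply/eqP;
  rewrite -(intr_eq0 rat) qE /p coef_poly ltnNge di mulr0.
apply/rowP => k; rewrite summxE mxE; apply/eqP; rewrite -(intr_eq0 rat) rmorph_sum /=.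
have uMk : \sum_(i < d.+1) u 0 i * (V i k)%:~R = 0.
  have := congr1 (fun r : 'rV_n => r 0 k) uM; rewrite !mxE; apply: etrans.
  by apply: eq_bigr => i _; rewrite mxE.
under eq_bigr => i _.
  rewrite !mxE rmorphM /= qE /p coef_poly ltn_ord inord_val -mulrA; over.
by rewrite /= -mulr_sumr uMk mulr0.
Qed.

Section FreeAbelian.
Local Open Scope group_scope.
Variables (L : groupType) (n : nat).
Hypothesis L_Zn : isomorphic_Zn L n.

Lemma isomorphic_Zn_commute (x y : L) : commute x y.
Proof.
have [f fD [g gK fK]] := L_Zn.
by rewrite -(fK x) -(fK y) /commute -!fD addrC.
Qed.

Lemma isomorphic_Zn_relation d (y : nat -> L) : (n <= d)%N ->
  exists c : {poly int}, [/\ c != 0%R, (size c <= d.+1)%N &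
    \prod_(0 <= i < d.+1) zpowg (y i) (c`_i)%R = 1].
Proof.
have [f fD [g gK fK]] := L_Zn => nd.
have f0 : f 0%R = 1 by apply: (@mulgI _ (f 0%R)); rewrite -fD addr0 mulg1.
have fZ (a : int) v : f (a *: v)%R = zpowg (f v) a.
  elim/int_rect: a => [|m IHm|m IHm]; first by rewrite scale0r f0.
    by rewrite -(addn1 m) PoszD scalerDl scale1r fD zpowgD IHm.
  have fN w : f (- w)%R = (f w)^-1 by apply: (@mulgI _ (f w)); rewrite -fD subrr mulgV.
  by rewrite -(addn1 m) PoszD opprD scalerDl scaleN1r fD zpowgD IHm fN.
pose V : 'M[int]_(d.+1, n) := (\matrix_(i, j) g (y i) 0%R j)%R.
have [c [c0 sc crel]] := int_row_relation V nd.
have gE : (\sum_(0 <= i < d.+1) c`_i *: g (y i) = 0)%R.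
  rewrite -[RHS]crel big_mkord; apply: eq_bigr => i _; congr (_ *: _)%R.
  by apply/rowP => j; rewrite !mxE.
exists c; split => //; rewrite -[RHS]f0 -[in RHS]gE (big_morph f fD f0).
by apply: eq_bigr => i _; rewrite fZ fK.
Qed.

End FreeAbelian.

Lemma subgroup_valM (G : groupType) (H : groupClosed G) :
  {morph (val : subgroup H -> G) : x y / (x * y)%g}.
Proof. exact: valM. Qed.

Section GeneratedSubgroup.
Local Open Scope group_scope.
Variables (G : groupType) (Y : set G).

Definition generated : {pred G} := fun g => `[< exists n, word_ball Y n g >].

Lemma generated_mul : mulg_closed generated.
Proof.
move=> x y /asboolP[m xm] /asboolP[n yn]; apply/asboolP.
by exists (m + n)%N; exact: word_ballM.
Qed.

Lemma generated_one : 1 \in generated.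
Proof. by apply/asboolP; exists 0%N; exact: word_ball_id. Qed.

Lemma generated_inv : invg_closed generated.
Proof. by move=> x /asboolP[n xn]; apply/asboolP; exists n; exact: word_ballV. Qed.

HB.instance Definition _ := isMulClosed.Build G generated generated_mul.
HB.instance Definition _ := isMul1Closed.Build G generated generated_one.
HB.instance Definition _ := isInvClosed.Build G generated generated_inv.

Lemma generated_gens : finite_set Y ->
  exists B : set (subgroup generated),
    [/\ finite_set B, generates B & val @` B = Y]%classic.
Proof.
(* The default 1 of [insubd] never occurs, since Y lies in [generated Y]. *)
move=> fY; pose B := (insubd (1 : subgroup generated) @` Y)%classic; exists B.
have vB : (val @` B = Y)%classic.
  rewrite image_comp -[RHS]image_id; apply: eq_imagel => y Yy /=.
  rewrite insubdK //; apply/asboolP; exists 1%N; exact: word_ball_gen.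
split=> //; first exact: finite_image.
move=> h; have /asboolP[n] : \val h \in generated := valP h.
rewrite -{1}vB word_ball_image; last exact: valM.
by case=> h' Bh' /val_inj <-; exists n.
Qed.

End GeneratedSubgroup.

(** * Subgroups of non-proper HNN extensions *)

Section HnnConjugation.
Local Open Scope group_scope.
Variables (K : groupType) (alpha : automorphism K).
Hypothesis alpha_free : ~ has_periodic_conjugacy_class alpha.
Local Notation G := (hnn alpha).
Local Notation iota := (fun k : K => Hnn alpha k 0%R).

Lemma hnn_stableM (g h : G) : hnn_stable (g * h) = (hnn_stable g + hnn_stable h)%R.
Proof. by []. Qed.

Lemma hnn_stableV (g : G) : hnn_stable g^-1 = (- hnn_stable g)%R.
Proof. by []. Qed.

Lemma hnn_stableX (g : G) n : hnn_stable (g ^+ n) = (hnn_stable g *+ n)%R.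
Proof. by elim: n => [|n IHn]; rewrite ?mulr0n // expgS hnn_stableM IHn mulrS. Qed.

Lemma hnn_base_inj : injective iota.
Proof. by move=> k l []. Qed.

Lemma hnn_stable0 (g : G) : hnn_stable g = 0%R -> g = iota (hnn_base g).
Proof. by case: g => k n /= ->. Qed.

(** For g = b t^n, commutation reads b alpha^n(k) = k b, so alpha^n(k) is conjugate to k. *)
Lemma hnn_commute_base (g : G) k :
  hnn_stable g <> 0%R -> commute g (iota k) -> k = 1.
Proof.
move=> g0 gk; apply: contrapT => k1; apply: alpha_free.
exists k, (hnn_stable g); split=> //; exists (hnn_base g)^-1.
apply: (@mulgI _ (hnn_base g)); rewrite invgK mulgA mulVKg.
by have := congr1 (@hnn_base _ _) gk; rewrite /= aut_exp0.
Qed.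

Variable a : G.
Hypothesis a_stable : hnn_stable a <> 0%R.

(** [hnn_base] loses nothing: the exponents of a and a^-1 cancel. *)
Definition conj_base (k : K) : K := hnn_base (a * iota k * a^-1).

Lemma conj_baseE k : iota (conj_base k) = a * iota k * a^-1.
Proof.
by rewrite /conj_base -hnn_stable0 // !hnn_stableM hnn_stableV addr0 subrr.
Qed.

Lemma conj_baseM : {morph conj_base : x y / x * y}.
Proof.
move=> x y; apply: hnn_base_inj; rewrite hnn_baseM !conj_baseE hnn_baseM.
by rewrite !mulgA mulgVK.
Qed.

Lemma conj_base_inj : injective conj_base.
Proof.
move=> x y /(congr1 iota); rewrite !conj_baseE => /mulIg/mulgI; exact: hnn_base_inj.
Qed.

Lemma conj_base_iter n k : iota (iter n conj_base k) * a ^+ n = a ^+ n * iota k.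
Proof.
elim: n => [|n IHn]; first by rewrite mulg1 mul1g.
by rewrite iterS conj_baseE [in LHS]expgS -!mulgA mulKg IHn expgS mulgA.
Qed.

Lemma conj_base_free r y : (0 < r)%N -> iter r conj_base y = y -> y = 1.
Proof.
move=> r0 yr; apply: (@hnn_commute_base (a ^+ r)).
  by rewrite hnn_stableX => /eqP; rewrite mulrn_eq0 eqn0Ngt r0 => /eqP.
by rewrite /commute -conj_base_iter yr.
Qed.

Variables (A : set G) (x : K) (c : nat).
Hypotheses (Aa : A a) (Ax : word_ball A c (iota x)).

Lemma conj_base_ball i : word_ball A (i + c + i) (iota (iter i conj_base x)).
Proof.
have Aai : word_ball A i (a ^+ i) by rewrite -[i in word_ball _ i _]mul1n;
  exact/word_ballX/word_ball_gen.
rewrite -(mulgK (a ^+ i) (iota _)) conj_base_iter.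
by apply: word_ballM (word_ballV Aai); exact: word_ballM.
Qed.

(** The product telescopes to x^e_0 a^s x^e_1 a^s ..., where each letter costs at most c + s. *)
Lemma binary_word_hnn_ball s w :
  word_ball A ((c + s) * size w)
    (iota (binary_word conj_base x s w) * a ^+ (s * size w)).
Proof.
elim: w => [|b w IHw]; first by rewrite /= !muln0 mulg1; exact: word_ball_id.
have -> : iota (binary_word conj_base x s (b :: w)) * a ^+ (s * (size w).+1) =
    (iota (x ^+ b) * a ^+ s) *
    (iota (binary_word conj_base x s w) * a ^+ (s * size w)).
  rewrite hnn_baseM mulnS expgnDr -!mulgA; congr (_ * _).
  by rewrite (mulgA (a ^+ s) (iota _)) -conj_base_iter -!mulgA.
rewrite /= mulnS.
apply: word_ballM IHw; apply: word_ballM; last first.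
  by rewrite -[s in word_ball _ s _]mul1n; exact/word_ballX/word_ball_gen.
by case: b; rewrite ?expg1 ?expg0 //; exact: word_ballW (word_ball_id _).
Qed.

End HnnConjugation.

(** * Uniform growth from an element outside K and a short element of K *)

Section HnnGrowth.
Local Open Scope group_scope.
Variables (R : realType) (u k : R) (d : nat).
Hypotheses (u1 : (1 < u)%R) (k1 : (1 <= k)%R).

Definition max_stride := (2 ^ size (bounded_roots d (3 ^ d)))%N.

Hypotheses (ku : (k ^+ (2 * d + 4) <= u)%R) (k2 : (k ^+ (4 + max_stride) <= 2)%R).

(** As x has length at most 4, x_i = a^i x a^-i with i <= d has length at most 2d + 4, and a letter
    of a binary word costs at most 4 + [max_stride]; these are the exponents imposed on k. *)
Lemma hnn_growth_ge (K : groupType) (alpha : automorphism K)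
    (A : set (hnn alpha)) a x n :
  torsion_free K ->
  (forall H : groupClosed K, finitely_generated (subgroup H) ->
     (u <= growth_constant (subgroup H) R)%R \/
     exists2 n : nat, (n <= d)%N & isomorphic_Zn (subgroup H) n) ->
  ~ has_periodic_conjugacy_class alpha ->
  finite_set A -> A a -> hnn_stable a <> 0%R ->
  x <> 1 -> word_ball A 4 (Hnn alpha x 0%R) ->
  (k ^+ n <= (growth_fun A n)%:R)%R.
Proof.
move=> tfK altK alpha_free fA Aa a0 x1 Ax.
have k0 : (0 <= k)%R by exact: le_trans k1.
set phi := conj_base a; pose Y := [set iter i phi x | i in `I_d.+1]%classic.
have fY : finite_set Y by apply: finite_image; exact: finite_II.
have [B [fB gB BY]] := generated_gens fY.
have [|uH|[m md HZ]] := altK (generated Y); first by exists B.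
  apply: (growth_fun_root _ fA k0 ku) => [m|]; last by rewrite addnS.
  apply: le_trans (growth_constant_le m _ uH fB gB) _;
    first by rewrite ltW // (lt_trans _ u1).
  (* Balls of [generated Y] are carried into K and then into the HNN extension. *)
  rewrite ler_nat -(growth_fun_image (@subgroup_valM _ _) val_inj m fB).
  rewrite BY -(growth_fun_image (@hnn_baseM _ alpha) (@hnn_base_inj _ alpha) m fY).
  apply: (growth_fun_ge fA (fset_uniq _)) => g; rewrite in_fset_set;
    last exact/finite_word_ball/finite_image.
  rewrite inE; apply: word_ball_trans => _ [_ [i /= id <-] <-].
  by apply: word_ballW (conj_base_ball Aa Ax i); lia.
have Y_in i : (i <= d)%N -> iter i phi x \in generated Y.
  by move=> id; apply/asboolP; exists 1%N; apply: word_ball_gen; exists i.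
pose y i : subgroup (generated Y) := insubd 1 (iter i phi x).
have yE i : (i <= d)%N -> \val (y i) = iter i phi x by move=> /Y_in; exact: insubdK.
have xX i : (i <= d)%N -> commute x (iter i phi x).
  move=> id; rewrite -(yE i id) -[X in commute X _](yE 0%N (leq0n d)).
  by rewrite /commute -!valM; congr \val; exact: (isomorphic_Zn_commute HZ).
have [c [c0 sc crel]] := isomorphic_Zn_relation HZ y md.
have phiM : {morph phi : x y / x * y} := conj_baseM a.
have phi_inj : injective phi := @conj_base_inj _ _ a.
have phi_free : forall r y, (0 < r)%N -> iter r phi y = y -> y = 1.
  exact: (conj_base_free alpha_free a0).
have [|j jJ words] := commuting_orbit_words tfK phiM phi_inj x1 phi_free xX sc c0.
  rewrite -[RHS](morph_one (@subgroup_valM _ (generated Y))) -[in RHS]crel.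
  rewrite (morph_prod_nat (@subgroup_valM _ _)) !big_nat.
  apply: eq_bigr => i /andP[_ id].
  by rewrite (morph_zpow (@subgroup_valM _ _)) [\val (y i)]yE.
apply: (@growth_fun_root _ _ A (4 + max_stride) n k 2 fA k0 k2) => [m'|//].
(* All words of length m' carry the same power of a, so distinct binary words give distinct
   elements. *)
pose word_elt v := Hnn alpha (binary_word phi x (2 ^ j) v) 0%R * a ^+ (2 ^ j * m').
have wA v : size v = m' ->
  word_ball A ((4 + max_stride) * m') (word_elt v).
  rewrite /word_elt => <-; apply: word_ballW (binary_word_hnn_ball Aa Ax _ _).
  by rewrite leq_mul2r leq_add2l leq_pexp2l ?orbT.
pose ws := [seq word_elt v | v : m'.-tuple bool].
have -> : (2 ^+ m' = (size ws)%:R :> R)%R.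
  by rewrite size_image card_tuple card_bool natrX.
rewrite ler_nat; apply: (growth_fun_ge fA) => [|g gws].
  rewrite map_inj_uniq ?enum_uniq // => v w /mulIg[evw].
  by apply/val_inj/(words v w); rewrite ?size_tuple.
have /mapP[v _ ->] := gws; apply: wA; exact: size_tuple.
Qed.

End HnnGrowth.

Section Isomorphism.
Local Open Scope group_scope.
Variables (G H : groupType) (f : G -> H) (g : H -> G).
Hypotheses (fM : {morph f : x y / x * y}) (fK : cancel f g) (gK : cancel g f).

Let gM : {morph g : x y / x * y}.
Proof. by move=> x y; apply: (can_inj fK); rewrite fM !gK. Qed.

Lemma generates_iso (A : set H) : generates A -> generates (g @` A)%classic.
Proof.
move=> gA x; have [n Ax] := gA (f x); exists n.
by rewrite word_ball_image; [exists (f x) | exact: gM].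
Qed.

Lemma finitely_generated_iso : finitely_generated H -> finitely_generated G.
Proof.
by move=> [A fA /generates_iso gA]; exists (g @` A)%classic => //; exact: finite_image.
Qed.

Lemma growth_constant_iso (R : realType) (u : R) :
  (0 <= u)%R -> finitely_generated H ->
  (u <= growth_constant G R)%R -> (u <= growth_constant H R)%R.
Proof.
move=> u0 fgH uG; apply: growth_constant_ge => // A fA gA n.
rewrite -(growth_fun_image gM (can_inj gK) n fA).
by apply: growth_constant_le => //; [exact: finite_image | exact: generates_iso].
Qed.

Lemma isomorphic_Zn_iso n : isomorphic_Zn G n -> isomorphic_Zn H n.
Proof.
move=> [h hD h_bij]; exists (f \o h); first by move=> x y /=; rewrite hD fM.
by apply: bij_comp h_bij; exists g.
Qed.

End Isomorphism.

(** * Subgroups lying in K or meeting K trivially *)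

Section HnnSubgroups.
Local Open Scope group_scope.
Variables (K : groupType) (alpha : automorphism K) (S : groupClosed (hnn alpha)).

(** The intersection of S with K, as a subgroup of K. *)
Definition base_part : {pred K} := fun k => Hnn alpha k 0%R \in S.

Lemma base_part_mul : mulg_closed base_part.
Proof. by move=> k l kS lS; rewrite /base_part unfold_in hnn_baseM; exact: gpredM. Qed.

Lemma base_part_one : 1 \in base_part.
Proof. exact: gpred1. Qed.

Lemma base_part_inv : invg_closed base_part.
Proof.
move=> k kS; rewrite unfold_in /base_part.
by rewrite (morph_inv (@hnn_baseM K alpha)) gpredV.
Qed.

HB.instance Definition _ := isMulClosed.Build K base_part base_part_mul.
HB.instance Definition _ := isMul1Closed.Build K base_part base_part_one.
HB.instance Definition _ := isInvClosed.Build K base_part base_part_inv.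

Lemma base_part_iso : (forall g, g \in S -> hnn_stable g = 0%R) ->
  exists (f : subgroup base_part -> subgroup S) g,
    [/\ {morph f : x y / x * y}, cancel f g & cancel g f].
Proof.
move=> S0.
pose f (h : subgroup base_part) : subgroup S :=
  Sub (Hnn alpha (\val h) 0%R) (valP h).
have gP (s : subgroup S) : hnn_base (\val s) \in base_part.
  by rewrite unfold_in /base_part -hnn_stable0 ?S0 //; exact: valP.
pose g s : subgroup base_part := Sub (hnn_base (\val s)) (gP s).
exists f, g; split.
- by move=> x y; apply: val_inj.
- by move=> h; apply: val_inj.
- by move=> s; apply: val_inj => /=; rewrite -hnn_stable0 // S0 //; exact: valP.
Qed.

Lemma hnn_stableZ (g : hnn alpha) a : hnn_stable (zpowg g a) = (a * hnn_stable g)%R.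
Proof.
case: a => n /=; rewrite ?hnn_stableV hnn_stableX -mulr_natl ?natz //.
by rewrite NegzE mulNr.
Qed.

(** The exponent map is injective on S; an element t of least positive exponent m generates S, by
    Euclidean division of exponents by m. *)
Lemma infinite_cyclic_part (s : hnn alpha) : s \in S -> hnn_stable s <> 0%R ->
  (forall g, g \in S -> hnn_stable g = 0%R -> g = 1) ->
  isomorphic_Zn (subgroup S) 1.
Proof.
move=> sS s0 S1.
pose P n := (0 < n)%N && `[< exists2 g, g \in S & hnn_stable g = n%:Z >].
have exP : exists n, P n.
  exists `|hnn_stable s|%N; rewrite /P absz_gt0; apply/andP; split; first exact/eqP.
  apply/asboolP; have [s_ge0|s_lt0] := leP 0%R (hnn_stable s).
    by exists s => //; rewrite gez0_abs.
  by exists s^-1; rewrite ?gpredV // hnn_stableV ltz0_abs.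
case: (ex_minnP exP) => m /andP[m0 /asboolP[t tS tm]] m_min.
have m_dvd g : g \in S -> ((hnn_stable g %/ m%:Z)%Z * m%:Z)%R = hnn_stable g.
  move=> gS; have zS a : zpowg t a \in S by case: a => n; rewrite ?gpredXNn ?gpredXn.
  have gE := divz_eq (hnn_stable g) m%:Z; rewrite [RHS]gE.
  suff -> : (hnn_stable g %% m%:Z)%Z = 0%R by rewrite addr0.
  have r_ge0 : (0 <= (hnn_stable g %% m%:Z)%Z)%R by apply: modz_ge0; lia.
  have r_lt : ((hnn_stable g %% m%:Z)%Z < m%:Z)%R by apply: ltz_pmod.
  apply: contrapT => r0; have := m_min `|(hnn_stable g %% m%:Z)%Z|%N.
  suff Pr : P `|(hnn_stable g %% m%:Z)%Z|%N by move=> /(_ Pr); lia.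
  apply/andP; split; first by lia.
  apply/asboolP; exists (g * zpowg t (- (hnn_stable g %/ m%:Z)%Z)%R);
    first by rewrite gpredM.
  by rewrite hnn_stableM hnn_stableZ tm {1}gE gez0_abs // mulNr addrAC subrr add0r.
pose s1 : subgroup S := Sub t tS.
have vZ a : \val (zpowg s1 a) = zpowg t a.
  exact: (morph_zpow (@subgroup_valM _ S)).
exists (fun v : 'rV_1 => zpowg s1 (v 0 0)%R); first by move=> v w; rewrite mxE zpowgD.
exists (fun h : subgroup S => const_mx (hnn_stable (\val h) %/ m%:Z)%Z) => [v|h].
  apply/rowP => i; rewrite mxE vZ hnn_stableZ tm mulzK ?(ord1 i) //.
  by rewrite eqz_nat -lt0n.
apply: val_inj; rewrite vZ mxE; apply/eqP; rewrite -divg_eq1; apply/eqP; apply: S1.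
  by rewrite gpredM ?gpredV ?(valP h) // -vZ; exact: valP.
by rewrite hnn_stableM hnn_stableV hnn_stableZ tm m_dvd ?subrr //; exact: valP.
Qed.

Lemma hnn_stable_word_ball (A : set (hnn alpha)) n g :
  (forall a, A a -> hnn_stable a = 0%R) -> word_ball A n g -> hnn_stable g = 0%R.
Proof.
move=> A0 [w [_ wA ->]]; rewrite big_seq;
  apply: (big_ind (fun g => hnn_stable g = 0%R)) => //.
  by move=> x y x0 y0; rewrite hnn_stableM x0 y0.
move=> a /wA[/A0 //|/A0]; rewrite hnn_stableV => /eqP; by rewrite oppr_eq0 => /eqP.
Qed.

End HnnSubgroups.

Lemma root_gt1 (R : realType) (u : R) (M : nat) : 1 < u -> (0 < M)%N ->
  exists2 k : R, 1 < k & k ^+ M <= Num.min u 2.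
Proof.
move=> u1 M0; set v := Num.min u 2; have v1 : 1 < v by rewrite lt_min u1 ltr1n.
have v0 : 0 <= v by rewrite ltW // (lt_trans _ v1).
have kM : (v `^ M%:R^-1) ^+ M = v.
  by rewrite -powR_mulrn ?powR_ge0 // -powRrM mulVf ?pnatr_eq0 -?lt0n // powRr1.
exists (v `^ M%:R^-1); last by rewrite kM.
rewrite ltNge; apply/negP => k1; move: v1; rewrite -kM ltNge => /negP; apply.
by rewrite exprn_ile1 ?powR_ge0.
Qed.

Theorem corollary5p4 (R : realType) (u : R) (d : nat) :
  1 < u -> (0 < d)%N ->
  exists2 k : R, 1 < k &
    forall K : groupType,
      finitely_generated K -> torsion_free K ->
      (forall H : groupClosed K, finitely_generated (subgroup H) ->
         u <= growth_constant (subgroup H) R \/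
         exists2 n : nat, (n <= d)%N & isomorphic_Zn (subgroup H) n) ->
    forall alpha : automorphism K, ~ has_periodic_conjugacy_class alpha ->
    forall S : groupClosed (hnn alpha), finitely_generated (subgroup S) ->
      k <= growth_constant (subgroup S) R \/
      exists2 n : nat, (n <= d)%N & isomorphic_Zn (subgroup S) n.
Proof.
(* One root of min(u, 2), of order the larger of the two exponents, serves both growth bounds and
   depends only on u and d. *)
move=> u1 d0; pose M := maxn (2 * d + 4) (4 + max_stride d).
have [|k k1 kM] := @root_gt1 R u M u1; first by rewrite leq_max addnS.
have k_le m : (m <= M)%N -> k ^+ m <= Num.min u 2.
  by move=> mM; apply: le_trans kM; rewrite ler_weXn2l // ltW.
exists k => // K _ tfK altK alpha alpha_free S fgS.
have [S0|] := pselect (forall g, g \in S -> hnn_stable g = 0).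
  have [f [g [fM fK gK]]] := base_part_iso S0.
  have [uH|[n nd HZ]] := altK (base_part S) (finitely_generated_iso fM fK gK fgS).
    left; apply: le_trans (growth_constant_iso fM fK gK _ fgS uH).
      by have := k_le 1%N; rewrite expr1 le_min leq_max addnS => /(_ isT)/andP[].
    by rewrite ltW // (lt_trans _ u1).
  by right; exists n => //; exact: (isomorphic_Zn_iso fM fK gK HZ).
move/existsNP => [s /not_implyP[sS s0]].
(* If S meets K trivially, it is infinite cyclic; the rank 1 is allowed because d > 0. *)
have [S1|] := pselect (forall g, g \in S -> hnn_stable g = 0 -> g = 1%g).
  by right; exists 1%N => //; exact: infinite_cyclic_part s0 S1.
move/existsNP => [g /not_implyP[gS /not_implyP[g0 g1]]]; left.
apply: growth_constant_ge => //; first by rewrite ltW // (lt_trans _ k1).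
move=> A fA gA n; rewrite -(growth_fun_image (@subgroup_valM _ S) val_inj n fA).
set B := (_ @` _)%classic; have fB : finite_set B by exact: finite_image.
have gB h : h \in S -> exists m, word_ball B m h.
  move=> hS; have [m Am] := gA (Sub h hS); exists m.
  by rewrite word_ball_image; [exists (Sub h hS) | exact: subgroup_valM].
have [a Ba a0] : exists2 a, B a & hnn_stable a <> 0.
  apply: contrapT => na; have [m Bm] := gB s sS;
    apply/s0/(hnn_stable_word_ball _ Bm) => a Ba.
  by apply: contrapT => a0; apply: na; exists a.
(* If all generators commuted, s would commute with g, a non-trivial element of K. *)
have [b [c [Bb Bc bc]]] : exists b c, [/\ B b, B c & ~ commute b c].
  apply: contrapT => nbc; apply: g1; rewrite (hnn_stable0 g0).
  have [m Bs] := gB s sS; have [m' Bg] := gB g gS.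
  rewrite (@hnn_commute_base _ _ alpha_free s (hnn_base g)) // -hnn_stable0 //.
  apply: commute_word_ball Bg => b Bb; apply/commute_sym.
  apply: commute_word_ball Bs => c Bc; apply: contrapT => bc.
  by apply: nbc; exists b, c.
(* The commutator of b and c has exponent 0, so it lies in K, and it has length at most 4. *)
have stab0 : hnn_stable [~ b, c]%g = 0.
  by rewrite /commg /conjg !hnn_stableM !hnn_stableV; lia.
have Bbc : word_ball B 4 [~ b, c]%g.
  have [Bb1 Bc1] := (word_ball_gen Bb, word_ball_gen Bc).
  apply: (@word_ballM _ B 1 3); first exact: word_ballV.
  apply: (@word_ballM _ B 1 2); first exact: word_ballV.
  exact: (@word_ballM _ B 1 1).
apply: (@hnn_growth_ge R u k d _ _ _ _ K alpha B a (hnn_base [~ b, c]%g)) => //.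
- exact: ltW.
- by apply: le_trans (k_le _ _) _; rewrite ?leq_maxl // ge_min lexx.
- by apply: le_trans (k_le _ _) _; rewrite ?leq_maxr // ge_min lexx orbT.
- by move=> bc1; apply/bc/commgP/eqP; rewrite (hnn_stable0 stab0) bc1.
- by rewrite -hnn_stable0.
Qed.
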